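(* Let $l$ denote an open curve in 3-space. Then for every $k\ge 0$ the $k$-th Vassiliev measure $w_k(l)$ of $l$ is a continuous function of the curve coordinates.
   Context: Diagrams and states. Let $D$ be a generic diagram of an oriented knotoid (a generic immersed oriented arc with over/under information at its double points, considered up to Reidemeister moves performed away from the endpoints), with $n_+$ positive and $n_-$ negative crossings. Each crossing can be replaced by its $A$-smoothing or its $B$-smoothing (at a positive crossing the $A$-smoothing is the orientation-respecting smoothing; at a negative crossing the $B$-smoothing is). An enhanced state $s$ of $D$ is a choice of smoothing at every crossing together with a sign $\pm$ on each resulting component (circle or arc). Put $i(s)$ = number of $B$-smoothings, $\lambda(s)$ = number of positive components minus number of negative components, $j(s)=i(s)+\lambda(s)$. Curves in 3-space. Curves are simple (without self-intersections). For $\vec\xi\in S^2$, $l_{\vec\xi}$ is the projection of $l$ to a plane with normal vector $\vec\xi$, viewed as a knotoid diagram, with set of enhanced states $S_{\vec\xi}$ and crossing numbers $n_{\pm,\vec\xi}$. The $k$-th Vassiliev measure of $l$ is $$w_k(l)=\frac{(-1)^k}{4\pi\,2^k k!}\int_{\vec\xi\in S^2}\sum_{s\in S_{\vec\xi}}(-1)^{i(s)+n_{-,\vec\xi}}\bigl(j(s)+n_{+,\vec\xi}-2n_{-,\vec\xi}\bigr)^k\,dA ,$$ the integral being over all of $S^2$ except a set of measure zero (the non-generic projection directions). For a polygonal curve the curve coordinates are the coordinates of its vertices. *)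

(* Defs.v *)
From HB Require Import structures.
From mathcomp Require Import all_boot all_order all_algebra.
From mathcomp Require Import all_classical all_reals all_analysis.

Set Implicit Arguments.
Unset Strict Implicit.
Unset Printing Implicit Defensive.
Import Order.TTheory GRing.Theory Num.Theory.
Import numFieldNormedType.Exports.

Local Open Scope classical_set_scope.
Local Open Scope ring_scope.

(** * Knotoid diagrams and enhanced states *)

(* A knotoid diagram is recorded by its signed Gauss data: the finite set of
   its crossings (taken in an ambient finite type T), the two parameter values
   at which the oriented arc runs through a crossing, on the upper and on the
   lower strand, and the sign of the crossing. Values outside [crossings] are
   irrelevant. *)
Record knotoid_diagram (R : realType) (T : finType) := KnotoidDiagram {
  crossings : {set T};
  over_time : T -> R;
  under_time : T -> R;
  positive : pred T }.

Section Diagram.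
Variables (R : realType) (T : finType) (D : knotoid_diagram R T).
Implicit Types (c : T) (B : {set T}).

Definition n_plus : nat := #|[set c in crossings D | positive D c]|.
Definition n_minus : nat := #|[set c in crossings D | ~~ positive D c]|.

(* N crossings cut the arc into 2N + 1 pieces, numbered along the
   orientation. *)
Definition piece : finType := 'I_(#|crossings D|.*2.+1).

Definition rank (x : R) : nat :=
  #|[set c in crossings D | over_time D c < x]| +
  #|[set c in crossings D | under_time D c < x]|.

Definition over_in c : piece := inord (rank (over_time D c)).
Definition over_out c : piece := inord (rank (over_time D c)).+1.
Definition under_in c : piece := inord (rank (under_time D c)).
Definition under_out c : piece := inord (rank (under_time D c)).+1.

(* A choice of smoothings is the set B of the B-smoothed crossings. The
   orientation-respecting smoothing is A at a positive crossing and B at a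
   negative one; it reconnects each incoming end to the outgoing end of the
   other strand. The other smoothing connects the two incoming ends and the
   two outgoing ends. *)
Definition oriented_smoothing B c : bool := positive D c (+) (c \in B).

Definition glued B : rel piece := fun x y =>
  [exists c in crossings D,
     if oriented_smoothing B c
     then ((x == over_in c) && (y == under_out c))
       || ((x == under_in c) && (y == over_out c))
     else ((x == over_in c) && (y == under_in c))
       || ((x == over_out c) && (y == under_out c))].

Definition components B : {set {set piece}} :=
  equivalence_partition (connect (fun x y => glued B x y || glued B y x))
    [set: piece]%SET.

(* An enhanced state: the set of B-smoothed crossings together with the set of
   the components labelled +. *)
Definition enhanced_states : {set {set T} * {set {set piece}}} :=
  [set s : {set T} * {set {set piece}} |
     (s.1 \subset crossings D) && (s.2 \subset components s.1)]%SET.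

Definition state_i (s : {set T} * {set {set piece}}) : nat := #|s.1|.

Definition state_lambda (s : {set T} * {set {set piece}}) : int :=
  #|s.2|%:Z - #|(components s.1 :\: s.2)%SET|%:Z.

Definition state_j (s : {set T} * {set {set piece}}) : int :=
  (state_i s)%:Z + state_lambda s.

Definition state_sum (k : nat) : int :=
  \sum_(s in enhanced_states)
    (-1) ^+ (state_i s + n_minus) *
    (state_j s + n_plus%:Z - 2 * n_minus%:Z) ^+ k.

End Diagram.

(** * Polygonal curves in 3-space and their projections *)

Section Space.
Variable R : realType.
Implicit Types u v w x xi : 'rV[R]_3.

Definition dot u v : R := (u *m v^T) 0 0.

Definition triple u v w : R := \det (col_mx u (col_mx v w) : 'M[R]_3).

(* For xi of norm 1, the orthogonal projection onto the plane normal to xi. *)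
Definition proj xi x : 'rV[R]_3 := x - dot x xi *: xi.

Definition sphere_point (phi theta : R) : 'rV[R]_3 :=
  \row_(i < 3) [:: sin phi * cos theta; sin phi * sin theta; cos phi]`_i.

(* The surface integral of f over A \cap S^2, in the parametrization
   [sphere_point], whose area element is sin phi dphi dtheta. *)
Definition sphere_integral (A : set 'rV[R]_3) (f : 'rV[R]_3 -> R) : R :=
  \int[(@lebesgue_measure R \x @lebesgue_measure R)%E]_(z in
      [set z | [/\ 0 <= z.1 <= pi, 0 <= z.2 <= 2 * pi &
                   A (sphere_point z.1 z.2)]])
    (f (sphere_point z.1 z.2) * sin z.1).

End Space.

Section Polygon.
Variables (R : realType) (n : nat).

(* A polygonal curve with n + 1 edges is the matrix whose n + 2 rows are the
   coordinates of its successive vertices. *)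
Variable l : 'M[R]_(n.+2, 3).
Implicit Types (i j : 'I_n.+1) (s t : R) (xi : 'rV[R]_3).

Definition vertex (v : 'I_n.+2) : 'rV[R]_3 := row v l.

Definition edge_vector i : 'rV[R]_3 :=
  vertex (lift ord0 i) - vertex (widen_ord (leqnSn n.+1) i).

(* The point of parameter i + t of the curve, for t in [0, 1]. *)
Definition edge_point i t : 'rV[R]_3 :=
  vertex (widen_ord (leqnSn n.+1) i) + t *: edge_vector i.

(* Injectivity of the curve on [0, n + 1]: no self-intersection, and distinct
   endpoints. *)
Definition simple_open : Prop :=
  forall i j s t, 0 <= s <= 1 -> 0 <= t <= 1 ->
    edge_point i s = edge_point j t -> i%:R + s = j%:R + t.

(* The first condition says that the projection passes only once through the
   image of each vertex; in particular edges do not degenerate, consecutive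
   edges do not overlap, and since two collinear overlapping edges would have
   a vertex of one on the other, all double points are transverse crossings
   interior to the edges. The second condition excludes triple points. *)
Definition generic xi : Prop :=
  (forall i t (v : 'I_n.+2), 0 <= t <= 1 ->
     proj xi (edge_point i t) = proj xi (vertex v) -> i%:R + t = v%:R) /\
  (forall (i1 i2 i3 : 'I_n.+1) (t1 t2 t3 : R),
     uniq [:: i1; i2; i3] -> 0 < t1 < 1 -> 0 < t2 < 1 -> 0 < t3 < 1 ->
     ~ (proj xi (edge_point i1 t1) = proj xi (edge_point i2 t2) /\
        proj xi (edge_point i2 t2) = proj xi (edge_point i3 t3))).

(* Local parameters of the double points of the projections of edges i and j;
   there is at most one when xi is generic and i <> j. *)
Definition double_points xi i j : set (R * R) :=
  [set st | [/\ 0 < st.1 < 1, 0 < st.2 < 1 &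
     proj xi (edge_point i st.1) = proj xi (edge_point j st.2)]].

Section Crossing.
Variables (xi : 'rV[R]_3) (c : 'I_n.+1 * 'I_n.+1).

Let st : R * R := get (double_points xi c.1 c.2).

(* xi points towards the viewer: the upper strand is the one further along
   xi. *)
Definition first_over : bool :=
  dot (edge_point c.2 st.2) xi < dot (edge_point c.1 st.1) xi.

Definition first_time : R := c.1%:R + st.1.
Definition second_time : R := c.2%:R + st.2.

Definition crossing_over_time : R :=
  if first_over then first_time else second_time.
Definition crossing_under_time : R :=
  if first_over then second_time else first_time.

(* The crossing is positive when (upper direction, lower direction) is a
   positive frame of the plane seen by the viewer. *)
Definition crossing_positive : bool :=
  if first_over then 0 < triple (edge_vector c.1) (edge_vector c.2) xi
  else 0 < triple (edge_vector c.2) (edge_vector c.1) xi.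

End Crossing.

Definition projection_diagram xi :
    knotoid_diagram R ('I_n.+1 * 'I_n.+1)%type :=
  {| crossings := [set c : 'I_n.+1 * 'I_n.+1 |
       (c.1 < c.2)%N && `[< double_points xi c.1 c.2 !=set0 >] ]%SET;
     over_time := crossing_over_time xi;
     under_time := crossing_under_time xi;
     positive := crossing_positive xi |}.

Definition vassiliev_measure (k : nat) : R :=
  (-1) ^+ k / (4 * pi * 2 ^+ k * k`!%:R) *
  sphere_integral [set xi | generic xi]
    (fun xi => (state_sum (projection_diagram xi) k)%:~R).

End Polygon.

(* Main.v *)
Require Import Defs.
From HB Require Import structures.
From mathcomp Require Import all_boot all_order all_algebra.
From mathcomp Require Import all_classical all_reals all_analysis.
From mathcomp Require Import measurable_realfun ring lra.
Import Order.TTheory GRing.Theory Num.Theory.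
Import numFieldNormedType.Exports.
Local Open Scope classical_set_scope.
Local Open Scope ring_scope.

Set Implicit Arguments.
Unset Strict Implicit.
Unset Printing Implicit Defensive.

(** The measure is an integral over the directions that are generic for the
    curve, written in spherical angles, and continuity in the curve is an
    instance of dominated convergence.

    The integrand depends on the curve and on the direction only through
    finitely many bits of the projection: which pairs of edges cross, with
    which signs, and in which order the strands are run through
    ([state_sum_same_data]). It therefore takes finitely many values
    ([state_sum_bounded]), and continuity comes down to two facts.

    Locally around a simple curve and a direction that is generic for it, these
    bits do not change, even when the curve and the direction move together
    ([near_generic], [near_same_data]). A double point of a generic projection
    is a transverse crossing of two edges, since edges that overlapped would
    lead to a vertex lying on another edge; hence its two parameters are given
    by Cramer's rule and move continuously. No two strands are run through at
    the same time, because there are no triple points, and the two heights at a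
    crossing differ because the curve is simple: every comparison that is made
    is strict, and persists. That no further double or triple point appears is
    a compactness argument on the closed edges.

    For a simple curve almost all directions are generic ([generic_ae]). If the
    projection puts a vertex on a point of an edge other than itself, then the
    direction lies in a plane through the origin chosen for this edge and this
    vertex. If it puts a triple point on three edges, then either the direction
    lies in one of finitely many planes, or it is a zero of the quadratic form
    [concurrency], which cannot then vanish identically because the three
    points of the curve are distinct. A nonzero quadratic form vanishes on a
    null subset of the sphere ([null_cone]): for all but countably many values
    of the second angle it restricts to a nonzero binary form in the cosine and
    the sine of the first one, which has countably many zeros.

    So, when simple curves converge to a simple curve, the integrands converge
    almost everywhere and are dominated by a constant
    ([vassiliev_measure_cvg]). *)

Local Notation proj := Defs.proj.

(** * Vector algebra in 3-space *)

Section Space.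
Variable R : realType.
Implicit Types (u v w x y xi : 'rV[R]_3) (a b c : R).

Lemma rV3P u v :
  u 0 0 = v 0 0 -> u 0 1 = v 0 1 -> u 0 2%:R = v 0 2%:R -> u = v.
Proof.
move=> h0 h1 h2; apply/rowP => -[[|[|[|//]]] Hi].
- by rewrite -[Ordinal _](_ : 0 = _) //; apply: val_inj.
- by rewrite -[Ordinal _](_ : 1 = _) //; apply: val_inj.
- by rewrite -[Ordinal _](_ : 2%:R = _) //; apply: val_inj.
Qed.

Lemma dotE u v :
  dot u v = u 0 0 * v 0 0 + u 0 1 * v 0 1 + u 0 2%:R * v 0 2%:R.
Proof.
rewrite /dot mxE !big_ord_recl big_ord0 !mxE addr0 addrA.
by congr (_ * _ + _ * _ + _ * _); congr (_ _ _); apply: val_inj.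
Qed.

Lemma det_mx33 (M : 'M[R]_3) : \det M =
    M 0 0 * (M 1 1 * M 2%:R 2%:R - M 1 2%:R * M 2%:R 1)
  - M 0 1 * (M 1 0 * M 2%:R 2%:R - M 1 2%:R * M 2%:R 0)
  + M 0 2%:R * (M 1 0 * M 2%:R 1 - M 1 1 * M 2%:R 0).
Proof.
have o0 (H : (0 < 3)%N) : Ordinal H = 0 by apply: val_inj.
have o1 (H : (1 < 3)%N) : Ordinal H = 1 by apply: val_inj.
have o2 (H : (2 < 3)%N) : Ordinal H = 2%:R by apply: val_inj.
pose N (i j : nat) := M (inord i) (inord j).
have NE i j : M i j = N i j by rewrite /N !inord_val.
rewrite (expand_det_row _ 0) !big_ord_recl big_ord0.
rewrite /cofactor !(expand_det_row _ 0) !big_ord_recl !big_ord0.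
rewrite /cofactor !det_mx11 !mxE !NE /= /bump /=.
rewrite !(addnE, add0n, addn0) /=.
ring.
Qed.

Lemma tripleE u v w : triple u v w =
    u 0 0 * (v 0 1 * w 0 2%:R - v 0 2%:R * w 0 1)
  - u 0 1 * (v 0 0 * w 0 2%:R - v 0 2%:R * w 0 0)
  + u 0 2%:R * (v 0 0 * w 0 1 - v 0 1 * w 0 0).
Proof.
have e0 : 0 = lshift (1 + 1) (0 : 'I_1) :> 'I_3 by apply: val_inj.
have e1 : 1 = rshift 1 (lshift 1 (0 : 'I_1)) :> 'I_3 by apply: val_inj.
have e2 : 2%:R = rshift 1 (rshift 1 (0 : 'I_1)) :> 'I_3 by apply: val_inj.
pose M : 'M[R]_3 := col_mx u (col_mx v w).
have M0 j : M 0 j = u 0 j by rewrite e0; exact: col_mxEu.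
have M1 j : M 1 j = v 0 j.
  by rewrite e1; apply: etrans (col_mxEd _ _ _ _) (col_mxEu _ _ _ _).
have M2 j : M 2%:R j = w 0 j.
  by rewrite e2; apply: etrans (col_mxEd _ _ _ _) (col_mxEd _ _ _ _).
by rewrite /triple -/M det_mx33 !M0 !M1 !M2.
Qed.

Lemma dot_gt0 u : u != 0 -> 0 < dot u u.
Proof.
move=> u0; rewrite lt_neqAle; apply/andP; split; last first.
  by rewrite dotE -!expr2 !addr_ge0 ?sqr_ge0.
apply: contra u0 => /eqP; rewrite dotE -!expr2 => h.
have [h0 h1 h2] : [/\ u 0 0 = 0, u 0 1 = 0 & u 0 2%:R = 0] by split; nra.
by apply/eqP/rV3P; rewrite ?h0 ?h1 ?h2 mxE.
Qed.

Lemma projE xi x (k : 'I_3) : proj xi x 0 k = x 0 k - dot x xi * xi 0 k.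
Proof. by rewrite /proj !mxE. Qed.

Lemma projD xi x y : proj xi (x + y) = proj xi x + proj xi y.
Proof. by apply/rowP => k; rewrite !(mxE, projE, dotE); ring. Qed.

Lemma projZ xi a x : proj xi (a *: x) = a *: proj xi x.
Proof. by apply/rowP => k; rewrite !(mxE, projE, dotE); ring. Qed.

Lemma projB xi x y : proj xi (x - y) = proj xi x - proj xi y.
Proof. by rewrite -scaleN1r projD projZ scaleN1r. Qed.

Lemma proj_eq xi x y : proj xi x = proj xi y <-> proj xi (x - y) = 0.
Proof.
by rewrite projB; split=> [->|/eqP]; rewrite ?subrr // subr_eq0 => /eqP.
Qed.

Lemma proj_eq0 xi x : proj xi x = 0 -> x = dot x xi *: xi.
Proof. by move/eqP; rewrite subr_eq0 => /eqP. Qed.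

Lemma proj_line xi a : dot xi xi = 1 -> proj xi (a *: xi) = 0.
Proof.
move=> h; rewrite projZ /proj h scale1r subrr scaler0 //.
Qed.

Lemma cramer3 u v w x : triple u v w *: x =
  triple x v w *: u + triple u x w *: v + triple u v x *: w.
Proof. by apply: rV3P; rewrite !mxE !tripleE; ring. Qed.

(** For independent [u] and [v] this is the cross product, up to a factor; the
    rank argument also covers dependent vectors. *)
Lemma exists_normal u v : exists2 x, x != 0 & dot x u = 0 /\ dot x v = 0.
Proof.
pose M : 'M[R]_(1 + 1, 3) := col_mx u v.
have K0 : kermx M^T != 0.
  rewrite -mxrank_eq0 mxrank_ker subn_eq0 -ltnNge.
  by rewrite mxrank_tr (leq_ltn_trans (rank_leq_row _)).
exists (nz_row (kermx M^T)); first by rewrite nz_row_eq0.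
have : nz_row (kermx M^T) *m M^T = 0.
  by apply/sub_kermxP; exact: nz_row_sub.
rewrite tr_col_mx mul_mx_row -row_mx0 => /eq_row_mx[h1 h2].
by rewrite /dot h1 h2 mxE.
Qed.

Lemma triple0_parallel u v :
  u != 0 -> (forall x, triple u v x = 0) -> exists a, v = a *: u.
Proof.
move=> u0 h.
have uu := dot_gt0 u0.
exists (dot v u / dot u u).
have h0 := h (\row_k (k == 0)%:R).
have h1 := h (\row_k (k == 1)%:R).
have h2 := h (\row_k (k == 2%:R)%:R).
rewrite tripleE !mxE /= in h0; rewrite tripleE !mxE /= in h1.
rewrite tripleE !mxE /= in h2.
have e0 : u 0 1 * v 0 2%:R - u 0 2%:R * v 0 1 = 0 by lra.
have e1 : u 0 0 * v 0 2%:R - u 0 2%:R * v 0 0 = 0 by lra.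
have e2 : u 0 0 * v 0 1 - u 0 1 * v 0 0 = 0 by lra.
suff E : dot u u *: v = dot v u *: u.
  by rewrite mulrC -scalerA -E scalerA mulVf ?scale1r // gt_eqF.
apply: rV3P; apply: subr0_eq; rewrite !mxE !dotE.
(* [(u.u) v - (v.u) u] is the double cross product of [u], [v] and [u], and
   the components of the inner cross product are zero by [e0], [e1], [e2]. *)
- transitivity (- u 0 1 * (u 0 0 * v 0 1 - u 0 1 * v 0 0)
                - u 0 2%:R * (u 0 0 * v 0 2%:R - u 0 2%:R * v 0 0)); first ring.
  by rewrite e1 e2 !mulr0 subr0.
- transitivity (u 0 0 * (u 0 0 * v 0 1 - u 0 1 * v 0 0)
                - u 0 2%:R * (u 0 1 * v 0 2%:R - u 0 2%:R * v 0 1)); first ring.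
  by rewrite e0 e2 !mulr0 subr0.
- transitivity (u 0 0 * (u 0 0 * v 0 2%:R - u 0 2%:R * v 0 0)
                + u 0 1 * (u 0 1 * v 0 2%:R - u 0 2%:R * v 0 1)); first ring.
  by rewrite e0 e1 !mulr0 addr0.
Qed.

(** The cross product of the two projections is parallel to [xi], and [triple u
    v xi] is its component along [xi]. *)
Lemma proj_parallel xi u v : dot xi xi = 1 -> proj xi u != 0 ->
  triple u v xi = 0 -> exists a, proj xi v = a *: proj xi u.
Proof.
move=> xi1 u0 h; apply: triple0_parallel => // x.
set u' := proj xi u; set v' := proj xi v.
have E : triple u' v' xi = 0.
  rewrite -h tripleE /u' /v' !projE [RHS]tripleE; ring.
have := congr1 (fun y => dot y xi) (cramer3 u' v' xi x).
rewrite E scale0r.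
have hp y : dot (proj xi y) xi = 0.
  transitivity (dot y xi - dot y xi * dot xi xi).
    by rewrite !(dotE, projE); ring.
  by rewrite xi1 mulr1 subrr.
have dl a b c (y z t : 'rV_3) : dot (a *: y + b *: z + c *: t) xi =
    a * dot y xi + b * dot z xi + c * dot t xi.
  by rewrite !dotE !mxE; ring.
rewrite dl !hp xi1 !mulr0 !add0r mulr1 => <-.
by rewrite dotE !mxE; ring.
Qed.

(** Cramer's rule in the plane normal to [xi], in which [triple u v xi] is the
    determinant of the projections of [u] and [v]. *)
Lemma planar_cramer xi u v x a b : dot xi xi = 1 -> triple u v xi != 0 ->
  proj xi (a *: u - b *: v - x) = 0 <->
  a = triple x v xi / triple u v xi /\ b = triple x u xi / triple u v xi.
Proof.
move=> xi1 D0; split.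
  move/proj_eq0; set c := dot _ _ => h.
  have -> : x = a *: u - b *: v - c *: xi.
    by rewrite -h opprB addrC subrK.
  have -> : triple (a *: u - b *: v - c *: xi) v xi = a * triple u v xi.
    by rewrite !tripleE !mxE; ring.
  have -> : triple (a *: u - b *: v - c *: xi) u xi = b * triple u v xi.
    by rewrite !tripleE !mxE; ring.
  by rewrite !mulfK.
case=> -> ->; set D := triple u v xi in D0 *.
have -> : (triple x v xi / D) *: u - (triple x u xi / D) *: v - x =
    (- (triple u v x / D)) *: xi; last by rewrite proj_line.
apply: (scalerI D0).
have -> : D *: ((triple x v xi / D) *: u - (triple x u xi / D) *: v - x) =
   triple x v xi *: u - triple x u xi *: v - D *: x.
  rewrite !scalerBr !scalerA; congr (_ *: _ - _ *: _ - _).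
    by rewrite mulrCA divff ?mulr1.
  by rewrite mulrCA divff ?mulr1.
rewrite scalerA mulrN mulrCA divff // mulr1.
rewrite /D cramer3; apply: rV3P; rewrite !mxE !tripleE; ring.
Qed.

(** For three lines of directions [u1], [u2], [u3] through points [p1], [p2],
    [p3], with [x2 = p2 - p1] and [x3 = p3 - p1], this quadratic form in [x]
    vanishes when the projections of the lines along [x] are concurrent. *)
Definition concurrency u1 u2 u3 x2 x3 x : R :=
  triple u3 u1 x * triple u2 x x2 + triple u1 u2 x * triple u3 x x3.

(** The assumption made on the shape of [x2] and [x3] is that the points of the
    lines with parameters [t1], [t2], [t3] lie on one line directed by [xi]. *)
Lemma concurrency_zero u1 u2 u3 xi (t1 t2 t3 a b : R) :
  concurrency u1 u2 u3 (a *: xi + t1 *: u1 - t2 *: u2)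
    (b *: xi + t1 *: u1 - t3 *: u3) xi = 0.
Proof. by rewrite /concurrency !tripleE !mxE; ring. Qed.

(** The form is not identically zero as soon as the second and the third point
    on the line directed by [xi] are distinct and the first line has a
    projection transverse to those of the two others. *)
Lemma concurrency_nonzero u1 u2 u3 xi (t1 t2 t3 a b : R) :
  concurrency u1 u2 u3 (a *: xi + t1 *: u1 - t2 *: u2)
    (b *: xi + t1 *: u1 - t3 *: u3) (xi + u1) =
  (b - a) * triple u1 u2 xi * triple u3 u1 xi.
Proof. by rewrite /concurrency !tripleE !mxE; ring. Qed.

End Space.

(** * State sums depend on finitely many bits *)

Section Diagrams.
Variables (R : realType) (T : finType).
Implicit Types (D E : knotoid_diagram R T) (c d : T) (k : nat).

Definition same_data D E : Prop :=
  crossings D = crossings E /\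
  {in crossings D, positive D =1 positive E} /\
  {in crossings D &, forall c d,
    [/\ (over_time D c < over_time D d) = (over_time E c < over_time E d),
        (over_time D c < under_time D d) = (over_time E c < under_time E d),
        (under_time D c < over_time D d) = (under_time E c < over_time E d) &
        (under_time D c < under_time D d) =
          (under_time E c < under_time E d)]}.

(** Strands are glued along pieces, the pieces are numbered by ranks, and a rank
    counts the strands that come earlier. *)
Lemma state_sum_same_data D E k :
  same_data D E -> state_sum D k = state_sum E k.
Proof.
case: D E => C o u p [C' o' u' p'] /= [/= EC]; rewrite -{}EC {C'}.
set D := KnotoidDiagram C o u p; set E := KnotoidDiagram C o' u' p'.
move=> [/= pE oE].
have rank_o c : c \in C -> rank D (o c) = rank E (o' c).
  move=> cC; rewrite /rank /=; congr (_ + _)%N; apply: eq_card => d;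
  by rewrite !inE /=; case: (boolP (d \in C)) => //= dC; case: (oE d c dC cC).
have rank_u c : c \in C -> rank D (u c) = rank E (u' c).
  move=> cC; rewrite /rank /=; congr (_ + _)%N; apply: eq_card => d;
  by rewrite !inE /=; case: (boolP (d \in C)) => //= dC; case: (oE d c dC cC).
have gE : @glued R T D = @glued R T E.
  apply: funext => B; apply: funext => x; apply: funext => y.
  apply: eq_existsb => c /=; case: (boolP (c \in C)) => //= cC.
  rewrite /oriented_smoothing /= (pE c cC).
  by rewrite /over_in /over_out /under_in /under_out /= rank_o ?rank_u.
have cE : components D = components E by rewrite /components gE.
have npE : n_plus D = n_plus E.
  apply: eq_card => c; rewrite !inE /=.
  by case: (boolP (c \in C)) => //= /pE ->.
have nmE : n_minus D = n_minus E.
  apply: eq_card => c; rewrite !inE /=.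
  by case: (boolP (c \in C)) => //= /pE ->.
rewrite /state_sum npE nmE; apply: eq_big => [s|s _].
  by rewrite /enhanced_states cE.
by rewrite /state_j /state_lambda cE.
Qed.

(** Diagrams with the same [code] have the same data, and the codes range over a
    finite type. *)
Lemma state_sum_bounded k :
  exists M : R, forall D, `|(state_sum D k)%:~R| <= M.
Proof.
pose code D := (crossings D, [ffun c => (c \in crossings D) && positive D c],
  [ffun z : T * T => [&& z.1 \in crossings D, z.2 \in crossings D &
     over_time D z.1 < over_time D z.2]],
  [ffun z : T * T => [&& z.1 \in crossings D, z.2 \in crossings D &
     over_time D z.1 < under_time D z.2]],
  [ffun z : T * T => [&& z.1 \in crossings D, z.2 \in crossings D &
     under_time D z.1 < over_time D z.2]],
  [ffun z : T * T => [&& z.1 \in crossings D, z.2 \in crossings D &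
     under_time D z.1 < under_time D z.2]]).
have codeP D E : code D = code E -> same_data D E.
  case=> h1 /ffunP h2 /ffunP h3 /ffunP h4 /ffunP h5 /ffunP h6.
  split=> //; split=> [c cD|c d cD dD].
    by have := h2 c; rewrite !ffunE -h1 cD.
  by split; [have := h3 (c, d)|have := h4 (c, d)|have := h5 (c, d)
    |have := h6 (c, d)]; rewrite !ffunE -h1 /= cD dD.
pose F z : R := if pselect (exists D, code D = z) is left ex_D
  then `|(state_sum (projT1 (cid ex_D)) k)%:~R| else 0.
have F0 z : 0 <= F z by rewrite /F; case: pselect.
exists (\sum_z F z) => D.
rewrite (bigD1 (code D)) //= {1}/F.
case: pselect => [ex_D|[]]; last by exists D.
case: cid => E /= /codeP/state_sum_same_data ->.
by rewrite lerDl sumr_ge0.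
Qed.

End Diagrams.

(** * Double points of a generic projection *)

Section Curve.
Variables (R : realType) (n : nat) (l : 'M[R]_(n.+2, 3)).
Implicit Types (i j : 'I_n.+1) (s t : R) (xi : 'rV[R]_3).

Local Notation ep := (edge_point l).
Local Notation ev := (edge_vector l).
Local Notation start i := (vertex l (widen_ord (leqnSn n.+1) i)).

Lemma edge_point0 i : ep i 0 = start i.
Proof. by rewrite /edge_point scale0r addr0. Qed.

Lemma edge_point1 i : ep i 1 = vertex l (lift ord0 i).
Proof. by rewrite /edge_point scale1r addrC subrK. Qed.

Lemma edge_pointD i s t : ep i (s + t) = ep i s + t *: ev i.
Proof. by rewrite /edge_point scalerDl addrA. Qed.

(** The ends of an edge are vertices, to which the first condition of
    genericity applies. *)
Lemma generic_end xi i j s t : generic l xi ->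
  0 <= t <= 1 -> (s == 0) || (s == 1) ->
  proj xi (ep i s) = proj xi (ep j t) -> i%:R + s = j%:R + t.
Proof.
move=> [gv _] t01 /orP[] /eqP -> /esym.
  by rewrite edge_point0 => /(gv _ _ _ t01) ->; rewrite addr0.
by rewrite edge_point1 => /(gv _ _ _ t01) ->; rewrite lift0 -natr1.
Qed.

Lemma itv01_cases s : 0 <= s <= 1 -> 0 < s < 1 \/ (s == 0) || (s == 1).
Proof.
move=> /andP[s0 s1]; have [//|n0] := eqVneq s 0; first by right.
have [//|n1] := eqVneq s 1; first by right.
by left; rewrite !lt_neqAle eq_sym n0 n1 s0.
Qed.

Lemma nat_neq_dist (a b : nat) : a <> b ->
  (a%:R + 1 <= b%:R :> R) \/ (b%:R + 1 <= a%:R :> R).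
Proof.
move=> /eqP; rewrite neq_ltn => /orP[] h; [left|right];
by rewrite natr1 ler_nat.
Qed.

Lemma three_unit_intervals (a b c : nat) (s t u : R) :
  a <> b -> b <> c -> a <> c ->
  0 <= s <= 1 -> 0 <= t <= 1 -> 0 <= u <= 1 ->
  a%:R + s = b%:R + t -> b%:R + t = c%:R + u -> False.
Proof.
move=> /nat_neq_dist ab /nat_neq_dist bc /nat_neq_dist ac *.
by case: ab; case: bc; case: ac => *; lra.
Qed.

Lemma unit_itv_nat (a b : nat) t : 0 <= t <= 1 -> a%:R + t = b%:R ->
  b = a \/ b = a.+1.
Proof.
move=> t01 e; have [->|/eqP/nat_neq_dist h] := eqVneq b a; first by left.
have [->|/eqP/nat_neq_dist h1] := eqVneq b a.+1; first by right.
by exfalso; move: h1; rewrite -!natr1; case: h => *; lra.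
Qed.

(** A triple point involving the end of an edge would give the same parameter
    along the curve on three different edges. *)
Lemma generic_triple xi i1 i2 i3 t1 t2 t3 : generic l xi ->
  uniq [:: i1; i2; i3] -> 0 <= t1 <= 1 -> 0 <= t2 <= 1 -> 0 <= t3 <= 1 ->
  proj xi (ep i1 t1) = proj xi (ep i2 t2) ->
  proj xi (ep i2 t2) = proj xi (ep i3 t3) -> False.
Proof.
move=> g u3 h1 h2 h3 e12 e23.
have [n12 n13 n23] : [/\ i1 <> i2 :> nat, i1 <> i3 :> nat & i2 <> i3 :> nat].
  move: u3; rewrite /= !inE negb_or andbT => /andP[/andP[/eqP a /eqP b] /eqP c].
  by split=> /val_inj.
have e13 := etrans e12 e23.
have [b1|end1] := itv01_cases h1; last first.
  exact: three_unit_intervals (nesym n12) n13 n23 h2 h1 h3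
    (esym (generic_end g h2 end1 e12)) (generic_end g h3 end1 e13).
have [b2|end2] := itv01_cases h2; last first.
  exact: three_unit_intervals n12 n23 n13 h1 h2 h3
    (esym (generic_end g h1 end2 (esym e12))) (generic_end g h3 end2 e23).
have [b3|end3] := itv01_cases h3; last first.
  exact: three_unit_intervals n13 (nesym n23) n12 h1 h3 h2
    (esym (generic_end g h1 end3 (esym e13)))
    (generic_end g h2 end3 (esym e23)).
by case: g => _ /(_ _ _ _ _ _ _ u3 b1 b2 b3); apply.
Qed.

Lemma generic_edge xi i : generic l xi -> proj xi (ev i) != 0.
Proof.
move=> [gv _]; apply/eqP => h.
have h1 : 0 <= (1 : R) <= 1 by rewrite ler01 lexx.
have /= := gv i 1 (widen_ord (leqnSn n.+1) i) h1.
by rewrite {1}/edge_point scale1r projD h addr0 => /(_ erefl); lra.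
Qed.

(** Starting inside the unit square and moving along a line that is parallel to
    none of its sides, one reaches its boundary. *)
Lemma exit_time (a b s t : R) : 0 < s < 1 -> 0 < t < 1 -> a != 0 -> b != 0 ->
  exists r, [/\ 0 < r, 0 <= s + r * a <= 1, 0 <= t + r * b <= 1 &
   ((s + r * a == 0) || (s + r * a == 1)) ||
   ((t + r * b == 0) || (t + r * b == 1))].
Proof.
have one (c x : R) : 0 < x < 1 -> c != 0 -> exists r, [/\ 0 < r,
   (x + r * c == 0) || (x + r * c == 1) &
   forall q, 0 < q <= r -> 0 <= x + q * c <= 1].
  move=> hx c0; have [cp|cn] := ltP 0 c.
    exists ((1 - x) / c); split.
    - by rewrite divr_gt0 //; lra.
    - by apply/orP; right; rewrite divfK //; lra.
    - by move=> q /andP[q0]; rewrite ler_pdivlMr // => hq; nra.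
  have {}cn : c < 0 by rewrite lt_neqAle c0.
  exists (x / - c); split.
  - by rewrite divr_gt0 //; lra.
  - by apply/orP; left; rewrite invrN mulrN mulNr divfK //; lra.
  - by move=> q /andP[q0]; rewrite ler_pdivlMr ?oppr_gt0 // => hq; nra.
move=> hs ht a0 b0.
have [r1 [r10 e1 h1]] := one a s hs a0; have [r2 [r20 e2 h2]] := one b t ht b0.
have [r12|r21] := leP r1 r2.
  by exists r1; split; rewrite ?e1 ?h1 ?h2 ?r10 ?lexx.
by exists r2; split; rewrite ?e2 ?orbT ?h1 ?h2 ?r20 ?lexx ?ltW.
Qed.

(** Two crossing edges with parallel projections would overlap, and following
    the overlap in both directions leads to two distinct points of it at which
    one of the edges ends. The curve takes the same parameter on both edges at
    such a point, which happens only at a vertex common to the two edges. *)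
Lemma double_point_transverse xi i j s t : generic l xi -> dot xi xi = 1 ->
  (i < j)%N -> 0 < s < 1 -> 0 < t < 1 ->
  proj xi (ep i s) = proj xi (ep j t) -> triple (ev i) (ev j) xi != 0.
Proof.
move=> g xi1 ij hs ht st; apply/eqP => D0.
have [a ha] := proj_parallel xi1 (generic_edge i g) D0.
have a0 : a != 0.
  by apply/eqP => a0; have /eqP[] := generic_edge j g; rewrite ha a0 scale0r.
have move_along r : proj xi (ep i (s + r * a)) = proj xi (ep j (t + r)).
  by rewrite !edge_pointD projD [RHS]projD !projZ ha scalerA st.
have meet r : 0 <= s + r * a <= 1 -> 0 <= t + r <= 1 ->
    ((s + r * a == 0) || (s + r * a == 1)) || ((t + r == 0) || (t + r == 1)) ->
    s + r * a = 1.
  move=> h1 h2 e; have ijR : i%:R + 1 <= j%:R :> R by rewrite natr1 ler_nat.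
  have : i%:R + (s + r * a) = j%:R + (t + r).
    case/orP: e => e; first exact: generic_end g h2 e (move_along r).
    exact/esym/(generic_end g h1 e)/esym/move_along.
  lra.
(* At both exits, forward and backward, the parameter on edge [i] would be
   1. *)
have [r [r0 rs rt re]] := exit_time hs ht a0 (oner_neq0 R).
have na0 : - a != 0 by rewrite oppr_eq0.
have n10 : -1 != 0 :> R by rewrite oppr_eq0 oner_neq0.
have [q [q0 qs qt qe]] := exit_time hs ht na0 n10.
rewrite !mulr1 in rt re; rewrite !mulrN1 in qt qe.
rewrite !mulrN -!mulNr in qs qe.
have e1 := meet r rs rt re; have e2 := meet (- q) qs qt qe.
have /eqP : (r + q) * a = 0 by lra.
by rewrite mulf_eq0 (negPf a0) orbF => /eqP; lra.
Qed.

(** Parameters on the edges [i] and [j] of the intersection point of the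
    projections of the lines that carry them. *)
Definition meet_param1 xi i j :=
  triple (start j - start i) (ev j) xi / triple (ev i) (ev j) xi.
Definition meet_param2 xi i j :=
  triple (start j - start i) (ev i) xi / triple (ev i) (ev j) xi.

Lemma meet_parameters xi i j s t : dot xi xi = 1 ->
  triple (ev i) (ev j) xi != 0 ->
  proj xi (ep i s) = proj xi (ep j t) <->
  s = meet_param1 xi i j /\ t = meet_param2 xi i j.
Proof.
move=> xi1 D0; rewrite /meet_param1 /meet_param2 -planar_cramer // proj_eq.
rewrite /edge_point [_ - (start j - _)]addrC opprB -addrA opprD addrA addrACA.
by rewrite -!addrA.
Qed.

(** Transverse lines meet only once, and the projections of these two already
    meet at the common vertex of the edges. *)
Lemma consecutive_no_double_point xi i j s t : generic l xi -> dot xi xi = 1 ->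
  j = i.+1 :> nat -> 0 < s < 1 -> 0 < t < 1 ->
  proj xi (ep i s) <> proj xi (ep j t).
Proof.
move=> g xi1 ji hs ht st.
have ij : (i < j)%N by rewrite ji.
have D0 := double_point_transverse g xi1 ij hs ht st.
have [s1 _] := (meet_parameters _ _ xi1 D0).1 st.
have : proj xi (ep i 1) = proj xi (ep j 0).
  rewrite edge_point0 edge_point1; congr (proj _ (vertex _ _)).
  by apply: val_inj; rewrite /= ji.
by move/(meet_parameters _ _ xi1 D0) => [+ _]; rewrite -s1; lra.
Qed.

End Curve.

(** * Crossings, their strands and their times *)

Lemma add_nat_inj (R : realType) (a b : nat) (s t : R) :
  0 < s < 1 -> 0 < t < 1 -> a%:R + s = b%:R + t -> a = b /\ s = t.
Proof.
move=> /andP[s0 s1] /andP[t0 t1] e.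
suff ab : a = b by move: e; rewrite ab => /addrI.
have [//|/eqP/(nat_neq_dist R)] := eqVneq a b; case=> *; exfalso; lra.
Qed.

Section Crossings.
Variables (R : realType) (n : nat) (l : 'M[R]_(n.+2, 3)) (xi : 'rV[R]_3).
Implicit Types (c d : 'I_n.+1 * 'I_n.+1) (a b : bool).

Local Notation ep := (edge_point l).
Local Notation ev := (edge_vector l).
Local Notation D := (projection_diagram l xi).

(** The two strands of a crossing are distinguished by a boolean, which is true
    for the strand on the edge [c.1]. *)
Definition strand_edge c a : 'I_n.+1 := if a then c.1 else c.2.

Definition strand_par c a : R :=
  if a then meet_param1 l xi c.1 c.2 else meet_param2 l xi c.1 c.2.

Definition strand_time c a : R := (strand_edge c a)%:R + strand_par c a.

Definition height_gap c : R :=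
  dot (ep c.1 (strand_par c true)) xi - dot (ep c.2 (strand_par c false)) xi.

Hypotheses (g : generic l xi) (xi1 : dot xi xi = 1).

Lemma crossing_spec c : c \in crossings D ->
  [/\ (c.1 < c.2)%N, triple (ev c.1) (ev c.2) xi != 0,
      forall a, 0 < strand_par c a < 1,
      forall a, proj xi (ep (strand_edge c a) (strand_par c a)) =
                proj xi (ep c.1 (strand_par c true)) &
      get (double_points l xi c.1 c.2) =
        (strand_par c true, strand_par c false)].
Proof.
rewrite inE => /andP[c12 /asboolP[[s t] [/= hs ht st]]].
have D0 := double_point_transverse g xi1 c12 hs ht st.
have [es et] := (meet_parameters _ _ xi1 D0).1 st.
have e1 : strand_par c true = s by rewrite es.
have e2 : strand_par c false = t by rewrite et.
split.
- exact: c12.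
- exact: D0.
- by case; rewrite ?e1 ?e2.
- case; first by rewrite e1 -es.
  by rewrite e2 -es; exact: esym st.
- rewrite -es -et; apply: get_unique => [|[s' t'] [/= _ _]]; first by split.
  by move/(meet_parameters _ _ xi1 D0) => [-> ->]; rewrite -es -et.
Qed.

Lemma mem_crossings c : (c.1 < c.2)%N ->
  triple (ev c.1) (ev c.2) xi != 0 ->
  (forall a, 0 < strand_par c a < 1) -> c \in crossings D.
Proof.
move=> c12 D0 h; rewrite inE c12 /=; apply/asboolP.
exists (strand_par c true, strand_par c false); split=> /=.
- exact: (h true).
- exact: (h false).
- exact/(meet_parameters _ _ xi1 D0).
Qed.

(** Distinct strands that are run through at the same time lie on one edge, and
    belong to crossings with two other edges: this is a triple point. *)
Lemma strand_time_inj c d a b : c \in crossings D -> d \in crossings D ->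
  strand_time c a = strand_time d b -> (c, a) = (d, b).
Proof.
move=> cD dD; have [c12 _ hc pc _] := crossing_spec cD.
have [d12 _ hd pd _] := crossing_spec dD; rewrite /strand_time => e.
have [/val_inj eedge epar] := add_nat_inj (hc a) (hd b) e.
have [eo|neo] := eqVneq (strand_edge c (~~ a)) (strand_edge d (~~ b)).
  have [<- <-] : c = d /\ a = b; last by [].
  case: c c12 eedge eo {cD hc pc e epar} => c1 c2 /=.
  case: d d12 {dD hd pd} => d1 d2 /=.
  move=> d12 c12; rewrite /strand_edge.
  case: a; case: b => /= ? ?; subst=> //.
    by have := ltn_trans c12 d12; rewrite ltnn.
  by have := ltn_trans c12 d12; rewrite ltnn.
exfalso.
have other c' a' : (c'.1 < c'.2)%N ->
    strand_edge c' (~~ a') != strand_edge c' a'.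
  move=> h; rewrite /strand_edge -val_eqE.
  by case: a' => /=; rewrite ?(gtn_eqF h) ?(ltn_eqF h).
have par01 c' a' : 0 < strand_par c' a' < 1 -> 0 <= strand_par c' a' <= 1.
  by case/andP=> /ltW -> /ltW ->.
apply: (@generic_triple _ _ l xi (strand_edge c (~~ a)) (strand_edge c a)
   (strand_edge d (~~ b)) (strand_par c (~~ a)) (strand_par c a)
   (strand_par d (~~ b)) g).
- by rewrite /= !inE negb_or other //= neo eedge eq_sym other.
- exact: par01.
- exact: par01.
- exact: par01.
- by rewrite !pc.
- by rewrite eedge epar !pd.
Qed.

(** Points with the same projection and the same height coincide. *)
Lemma height_gap_neq0 c : simple_open l -> c \in crossings D ->
  height_gap c != 0.
Proof.
move=> simple_l cD; have [c12 _ hc pc _] := crossing_spec cD.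
rewrite /height_gap subr_eq0; apply/eqP => h.
have hc1 := hc true; have hc2 := hc false.
have : ep c.1 (strand_par c true) = ep c.2 (strand_par c false).
  by have := pc false; rewrite /Defs.proj /= h => /addIr ->.
move=> /simple_l e.
have : c.1%:R + strand_par c true = c.2%:R + strand_par c false.
  by apply: e; lra.
have : c.1%:R + 1 <= c.2%:R :> R by rewrite natr1 ler_nat.
by move=> *; lra.
Qed.

Lemma first_overE c : c \in crossings D ->
  first_over l xi c = (0 < height_gap c).
Proof.
move=> cD; have [_ _ _ _ e] := crossing_spec cD.
by rewrite /first_over e subr_gt0.
Qed.

Lemma over_timeE c : c \in crossings D ->
  over_time D c = strand_time c (0 < height_gap c).
Proof.
move=> cD; have [_ _ _ _ e] := crossing_spec cD.
rewrite /= /crossing_over_time first_overE // /first_time /second_time e.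
by case: ifP.
Qed.

Lemma under_timeE c : c \in crossings D ->
  under_time D c = strand_time c (~~ (0 < height_gap c)).
Proof.
move=> cD; have [_ _ _ _ e] := crossing_spec cD.
rewrite /= /crossing_under_time first_overE // /first_time /second_time e.
by case: ifP.
Qed.

Lemma positiveE c : c \in crossings D ->
  positive D c = (0 < height_gap c) (+) ~~ (0 < triple (ev c.1) (ev c.2) xi).
Proof.
move=> cD; have [_ D0 _ _ e] := crossing_spec cD.
rewrite /= /crossing_positive first_overE //.
have -> : triple (ev c.2) (ev c.1) xi = - triple (ev c.1) (ev c.2) xi.
  by rewrite !tripleE; ring.
rewrite oppr_gt0 [_ < 0]lt_neqAle D0 /= leNgt.
by case: (0 < height_gap c); case: (0 < _).
Qed.

End Crossings.

(** * Continuity in the curve and in the direction *)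

Section Continuity.
Variables (R : realType) (T : topologicalType) (p : T).
Implicit Types (f g h : T -> 'rV[R]_3) (a b : T -> R).

(** Continuity at [p], stated for coordinates so that it follows from limits of
    real functions. *)
Definition coord_cvg f := forall k, f q 0 k @[q --> p] --> f p 0 k.

Lemma coord_cvgD f g : coord_cvg f -> coord_cvg g ->
  coord_cvg (fun q => f q + g q).
Proof.
move=> hf hg k; rewrite mxE; under eq_fun do rewrite mxE.
by apply: cvgD; [exact: hf|exact: hg].
Qed.

Lemma coord_cvgZ a f : a q @[q --> p] --> a p -> coord_cvg f ->
  coord_cvg (fun q => a q *: f q).
Proof.
move=> ha hf k; rewrite mxE; under eq_fun do rewrite mxE.
by apply: cvgM => //; exact: hf.
Qed.

Lemma coord_cvgB f g : coord_cvg f -> coord_cvg g ->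
  coord_cvg (fun q => f q - g q).
Proof.
move=> hf hg k; rewrite !mxE; under eq_fun do rewrite !mxE.
by apply: cvgB; [exact: hf|exact: hg].
Qed.

Lemma cvg_dot f g : coord_cvg f -> coord_cvg g ->
  dot (f q) (g q) @[q --> p] --> dot (f p) (g p).
Proof.
move=> hf hg; rewrite dotE; under eq_fun do rewrite dotE.
by apply: cvgD; [apply: cvgD|]; apply: cvgM; (exact: hf || exact: hg).
Qed.

Lemma cvg_triple f g h : coord_cvg f -> coord_cvg g -> coord_cvg h ->
  triple (f q) (g q) (h q) @[q --> p] --> triple (f p) (g p) (h p).
Proof.
move=> hf hg hh; rewrite tripleE; under eq_fun do rewrite tripleE.
apply: cvgD; [apply: cvgB|]; apply: cvgM; try exact: hf.
all: by apply: cvgB; apply: cvgM; (exact: hg || exact: hh).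
Qed.

Lemma coord_cvg_proj f g : coord_cvg f -> coord_cvg g ->
  coord_cvg (fun q => proj (f q) (g q)).
Proof.
move=> hf hg; apply: coord_cvgB => //.
by apply: coord_cvgZ => //; exact: cvg_dot.
Qed.

Lemma coord_cvg_neq0 f : coord_cvg f -> f p != 0 -> \forall q \near p, f q != 0.
Proof.
move=> hf; case/rV0Pn => k /(cvgr_neq0 _ (hf k)).
by apply: filterS => q hq; apply/rV0Pn; exists k.
Qed.

Lemma near_sign a : a q @[q --> p] --> a p -> a p != 0 ->
  \forall q \near p, (0 < a q) = (0 < a p).
Proof.
move=> ha; rewrite neq_lt => /orP[a0|a0].
  by apply: filterS (cvgr_lt _ ha _ a0) => q hq; rewrite !ltNge !ltW.
by apply: filterS (cvgr_gt _ ha _ a0) => q hq; rewrite a0 hq.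
Qed.

End Continuity.

Section PolygonContinuity.
Variables (R : realType) (n : nat) (T : topologicalType) (p : T).
Variables (l : T -> 'M[R]_(n.+2, 3)) (z : T -> R * R).
Hypotheses (hl : l q @[q --> p] --> l p) (hz : z q @[q --> p] --> z p).
Implicit Types (i j : 'I_n.+1) (s : T -> R).

Lemma coord_cvg_vertex v : coord_cvg p (fun q => vertex (l q) v).
Proof.
move=> k; rewrite mxE; under eq_fun do rewrite mxE.
exact: (cvg_comp _ _ hl (@coord_continuous _ _ _ v k (l p))).
Qed.

Lemma coord_cvg_edge_vector i : coord_cvg p (fun q => edge_vector (l q) i).
Proof. by apply: coord_cvgB; exact: coord_cvg_vertex. Qed.

Lemma coord_cvg_edge_point i s : s q @[q --> p] --> s p ->
  coord_cvg p (fun q => edge_point (l q) i (s q)).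
Proof.
move=> hs; apply: coord_cvgD; first exact: coord_cvg_vertex.
by apply: coord_cvgZ => //; exact: coord_cvg_edge_vector.
Qed.

Lemma coord_cvg_sphere_point :
  coord_cvg p (fun q => sphere_point (z q).1 (z q).2).
Proof.
have h1 : (z q).1 @[q --> p] --> (z p).1 by exact: cvg_comp hz cvg_fst.
have h2 : (z q).2 @[q --> p] --> (z p).2 by exact: cvg_comp hz cvg_snd.
have c1 := cvg_comp _ _ h1 (@continuous_cos R (z p).1).
have s1 := cvg_comp _ _ h1 (@continuous_sin R (z p).1).
have c2 := cvg_comp _ _ h2 (@continuous_cos R (z p).2).
have s2 := cvg_comp _ _ h2 (@continuous_sin R (z p).2).
move=> k; rewrite mxE; under eq_fun do rewrite mxE.
by case: k => -[|[|[|//]]] /= _; [apply: cvgM|apply: cvgM|].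
Qed.

End PolygonContinuity.

Lemma dot_sphere_point (R : realType) (phi theta : R) :
  dot (sphere_point phi theta) (sphere_point phi theta) = 1.
Proof.
rewrite dotE !mxE /=.
transitivity (sin phi ^+ 2 * (cos theta ^+ 2 + sin theta ^+ 2) + cos phi ^+ 2).
  by ring.
by rewrite cos2Dsin2 mulr1 addrC cos2Dsin2.
Qed.

(** The tube lemma. Two functions are needed for triple points, which are the
    common zeros of two maps into the plane of projection. *)
Lemma near_compact_neq0_or (R : realType) (K U : topologicalType) (A : set K)
    (u0 : U) (f g : K * U -> 'rV[R]_3) : compact A ->
  (forall t, A t -> coord_cvg (t, u0) f) ->
  (forall t, A t -> coord_cvg (t, u0) g) ->
  (forall t, A t -> f (t, u0) != 0 \/ g (t, u0) != 0) ->
  \forall u \near u0, forall t, A t -> f (t, u) != 0 \/ g (t, u) != 0.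
Proof.
move=> /compact_near_coveringP cA hf hg fg0.
apply: (cA _ _ (fun u t => f (t, u) != 0 \/ g (t, u) != 0)) => t At.
case: (fg0 t At) => [/(coord_cvg_neq0 (hf t At))|/(coord_cvg_neq0 (hg t At))].
  by apply: filterS => -[t' u] /= ?; left.
by apply: filterS => -[t' u] /= ?; right.
Qed.

Lemma near_compact_neq0 (R : realType) (K U : topologicalType) (A : set K)
    (u0 : U) (f : K * U -> 'rV[R]_3) : compact A ->
  (forall t, A t -> coord_cvg (t, u0) f) ->
  (forall t, A t -> f (t, u0) != 0) ->
  \forall u \near u0, forall t, A t -> f (t, u) != 0.
Proof.
move=> cA hf f0.
have := near_compact_neq0_or cA hf hf (fun t At => or_introl (f0 t At)).
by apply: filterS => u h t /h[].
Qed.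

(** * Genericity is an open condition *)

Lemma near_forall (T : topologicalType) (p : T) (I : finType)
    (P : I -> T -> Prop) :
  (forall i, \forall q \near p, P i q) -> \forall q \near p, forall i, P i q.
Proof. exact: filter_forall. Qed.

Lemma near_forall_in (T : topologicalType) (p : T) (I : finType) (A : pred I)
    (P : I -> T -> Prop) : (forall i, A i -> \forall q \near p, P i q) ->
  \forall q \near p, forall i, A i -> P i q.
Proof.
move=> h; apply: near_forall => i; have [/h|nA] := pselect (A i).
  by apply: filterS => q.
by apply: (@nearW _ (nbhs p)) => q /nA.
Qed.

Section Near.
Variables (R : realType) (n : nat).
Local Notation curve := 'M[R]_(n.+2, 3).
Implicit Types (i j : 'I_n.+1) (u : curve * (R * R)) (z : R * R) (l : curve).

Local Notation sph z := (sphere_point z.1 z.2).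
Local Notation diag u := (projection_diagram u.1 (sph u.2)).

Definition unit_itv : set R := [set t | 0 <= t <= 1].

Lemma compact_unit_itv : compact unit_itv.
Proof. by rewrite /unit_itv -set_itvcc; exact: segment_compact. Qed.

Lemma cvg_factors (K : topologicalType) (q : K * (curve * (R * R))) :
  [/\ r.2.1 @[r --> q] --> q.2.1, r.2.2 @[r --> q] --> q.2.2 &
      r.1 @[r --> q] --> q.1].
Proof.
have h : r.2 @[r --> q] --> q.2 by exact: cvg_snd.
split; last exact: cvg_fst.
- exact: cvg_comp h cvg_fst.
- exact: cvg_comp h cvg_snd.
Qed.

(** Each condition says that continuous maps on a compact set of parameters have
    no common zero, except that a vertex does lie on the edges that end at it:
    there the condition amounts to the projection of the edge being nonzero. *)
Lemma near_generic u0 : generic u0.1 (sph u0.2) ->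
  \forall u \near u0, generic u.1 (sph u.2).
Proof.
move=> g; have h1 : u.1 @[u --> u0] --> u0.1 by exact: cvg_fst.
have h2 : u.2 @[u --> u0] --> u0.2 by exact: cvg_snd.
apply: filterI.
  suff : \forall u \near u0, forall i (v : 'I_n.+2), forall t, 0 <= t <= 1 ->
      proj (sph u.2) (edge_point u.1 i t) = proj (sph u.2) (vertex u.1 v) ->
      i%:R + t = v%:R by apply: filterS => u h i t v; exact: h.
  apply: (@near_forall _ u0) => i; apply: (@near_forall _ u0) => v.
  have edge0 : \forall u \near u0, proj (sph u.2) (edge_vector u.1 i) != 0.
    apply: (@coord_cvg_neq0 _ _ u0
      (fun u => proj (sph u.2) (edge_vector u.1 i))).
      apply: coord_cvg_proj; first exact: coord_cvg_sphere_point.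
      exact: coord_cvg_edge_vector.
    exact: generic_edge.
  have [vi|vi] := eqVneq (val v) i.
    apply: filterS edge0 => u e0 t _.
    have -> : v = widen_ord (leqnSn n.+1) i by apply: val_inj.
    rewrite -edge_point0 -{1}[t]add0r edge_pointD projD projZ.
    rewrite -[RHS]addr0 => /addrI/eqP; rewrite scaler_eq0 (negPf e0) orbF.
    by move=> /eqP ->; rewrite addr0.
  have [vi1|vi1] := eqVneq (val v) i.+1.
    apply: filterS edge0 => u e0 t _.
    have -> : v = lift ord0 i by apply: val_inj; rewrite vi1 -lift0.
    rewrite -edge_point1 -{1}[t](subrK 1) addrC edge_pointD projD projZ.
    rewrite -[RHS]addr0 => /addrI/eqP; rewrite scaler_eq0 (negPf e0) orbF.
    by rewrite subr_eq0 => /eqP ->; rewrite lift0 natr1.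
  pose f (q : R * (curve * (R * R))) :=
    proj (sph q.2.2) (edge_point q.2.1 i q.1 - vertex q.2.1 v).
  have cf q : coord_cvg q f.
    have [c1 c2 c3] := cvg_factors q.
    apply: coord_cvg_proj; first exact: coord_cvg_sphere_point.
    by apply: coord_cvgB; [exact: coord_cvg_edge_point|exact: coord_cvg_vertex].
  have : \forall u \near u0, forall t, unit_itv t -> f (t, u) != 0.
    apply: (near_compact_neq0 compact_unit_itv (fun t _ => cf (t, u0))).
    move=> t t01; apply/eqP => /proj_eq; case: g => g _ /(g _ _ _ t01).
    move=> /(unit_itv_nat t01) [] e; [move: vi|move: vi1]; by rewrite -e eqxx.
  by apply: filterS => u h t t01 /proj_eq e; have := h t t01; rewrite /f e eqxx.
suff : \forall u \near u0, forall i1 i2 i3, uniq [:: i1; i2; i3] ->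
    forall t : R * (R * R), (unit_itv `*` (unit_itv `*` unit_itv)) t ->
    ~ (proj (sph u.2) (edge_point u.1 i1 t.1) =
         proj (sph u.2) (edge_point u.1 i2 t.2.1) /\
       proj (sph u.2) (edge_point u.1 i2 t.2.1) =
         proj (sph u.2) (edge_point u.1 i3 t.2.2)).
  apply: filterS => u h i1 i2 i3 t1 t2 t3 i123.
  move=> /andP[/ltW a1 /ltW b1] /andP[/ltW a2 /ltW b2] /andP[/ltW a3 /ltW b3].
  apply: (h _ _ _ i123 (t1, (t2, t3))); rewrite /unit_itv.
  by do ?split => /=; rewrite ?a1 ?a2 ?a3.
apply: (@near_forall _ u0) => i1; apply: (@near_forall _ u0) => i2.
apply: (@near_forall_in _ u0) => i3 i123.
pose f1 (q : (R * (R * R)) * (curve * (R * R))) :=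
  proj (sph q.2.2) (edge_point q.2.1 i1 q.1.1 - edge_point q.2.1 i2 q.1.2.1).
pose f2 (q : (R * (R * R)) * (curve * (R * R))) :=
  proj (sph q.2.2) (edge_point q.2.1 i2 q.1.2.1 - edge_point q.2.1 i3 q.1.2.2).
pose params := ((R * (R * R)) * (curve * (R * R)))%type.
have c11 (q : params) : r.1.1 @[r --> q] --> q.1.1.
  by have [_ _ c] := cvg_factors q; exact: cvg_comp c cvg_fst.
have c12 (q : params) : r.1.2 @[r --> q] --> q.1.2.
  by have [_ _ c] := cvg_factors q; exact: cvg_comp c cvg_snd.
have c121 (q : params) : r.1.2.1 @[r --> q] --> q.1.2.1.
  exact: cvg_comp (c12 q) cvg_fst.
have c122 (q : params) : r.1.2.2 @[r --> q] --> q.1.2.2.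
  exact: cvg_comp (c12 q) cvg_snd.
have cf1 q : coord_cvg q f1.
  have [c1 c2 c3] := cvg_factors q.
  apply: coord_cvg_proj; first exact: coord_cvg_sphere_point.
  by apply: coord_cvgB; exact: coord_cvg_edge_point.
have cf2 q : coord_cvg q f2.
  have [c1 c2 c3] := cvg_factors q.
  apply: coord_cvg_proj; first exact: coord_cvg_sphere_point.
  by apply: coord_cvgB; exact: coord_cvg_edge_point.
have K3 : compact (unit_itv `*` (unit_itv `*` unit_itv)).
  by apply: compact_setX; [|apply: compact_setX]; exact: compact_unit_itv.
have : \forall u \near u0, forall t,
    (unit_itv `*` (unit_itv `*` unit_itv)) t ->
    f1 (t, u) != 0 \/ f2 (t, u) != 0.
  apply: (near_compact_neq0_or K3 (fun t _ => cf1 (t, u0))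
    (fun t _ => cf2 (t, u0))) => -[t1 [t2 t3]] /= [h3 [h4 h5]].
  have [z1|nz1] := eqVneq (f1 ((t1, (t2, t3)), u0)) 0; last exact: or_introl.
  have [z2|nz2] := eqVneq (f2 ((t1, (t2, t3)), u0)) 0; last exact: or_intror.
  exfalso; apply: (generic_triple g i123 h3 h4 h5); first exact/proj_eq/z1.
  exact/proj_eq/z2.
apply: filterS => u h t /h; rewrite /f1 /f2 /= => ht [/proj_eq e1 /proj_eq e2].
by case: ht => /eqP h0; [exact: h0 e1|exact: h0 e2].
Qed.

End Near.

(** * The combinatorial data are locally constant *)

Section LocallyConstant.
Variables (R : realType) (n : nat).
Local Notation curve := 'M[R]_(n.+2, 3).
Implicit Types (i j : 'I_n.+1) (u : curve * (R * R)) (z : R * R) (l : curve).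

Local Notation sph z := (sphere_point z.1 z.2).
Local Notation diag u := (projection_diagram u.1 (sph u.2)).


Variable u0 : curve * (R * R).
Hypotheses (simple0 : simple_open u0.1) (g0 : generic u0.1 (sph u0.2)).
Implicit Types (c d : 'I_n.+1 * 'I_n.+1) (a b : bool).

Local Notation det u c :=
  (triple (edge_vector u.1 c.1) (edge_vector u.1 c.2) (sph u.2)).
Local Notation par u c a := (strand_par u.1 (sph u.2) c a).
Local Notation time u c a := (strand_time u.1 (sph u.2) c a).
Local Notation gap u c := (height_gap u.1 (sph u.2) c).

Let cvg1 : u.1 @[u --> u0] --> u0.1. Proof. exact: cvg_fst. Qed.
Let cvg2 : u.2 @[u --> u0] --> u0.2. Proof. exact: cvg_snd. Qed.
Let unit_sph (v : R * R) : dot (sph v) (sph v) = 1.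
Proof. exact: dot_sphere_point. Qed.

Let cvg_sph : coord_cvg u0 (fun u => sph u.2).
Proof. exact: coord_cvg_sphere_point. Qed.

Lemma cvg_det c : det u c @[u --> u0] --> det u0 c.
Proof.
by apply: cvg_triple => //; exact: coord_cvg_edge_vector.
Qed.

Lemma cvg_strand_par c a : det u0 c != 0 ->
  par u c a @[u --> u0] --> par u0 c a.
Proof.
move=> D0; have cd : coord_cvg u0 (fun u =>
    vertex u.1 (widen_ord (leqnSn n.+1) c.2) -
    vertex u.1 (widen_ord (leqnSn n.+1) c.1)).
  by apply: coord_cvgB; exact: coord_cvg_vertex.
have cD := @cvg_det c.
by case: a; apply: cvgM; (try exact: cvgV); apply: cvg_triple => //;
  exact: coord_cvg_edge_vector.
Qed.

Lemma cvg_strand_time c a : det u0 c != 0 ->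
  time u c a @[u --> u0] --> time u0 c a.
Proof. by move=> D0; apply: cvgD; [exact: cvg_cst|exact: cvg_strand_par]. Qed.

Lemma cvg_height_gap c : det u0 c != 0 -> gap u c @[u --> u0] --> gap u0 c.
Proof.
move=> D0; apply: cvgB; apply: cvg_dot => //; apply: coord_cvg_edge_point => //;
exact: cvg_strand_par.
Qed.

(** A crossing persists because its determinant stays nonzero and its parameters
    stay inside the edges. None appears on consecutive edges by genericity of
    the nearby projections, nor on other edges by compactness, since their
    projections are disjoint up to the ends when they do not cross. *)
Lemma near_crossings :
  \forall u \near u0, crossings (diag u) = crossings (diag u0).
Proof.
suff : \forall u \near u0, forall c,
    (c \in crossings (diag u)) = (c \in crossings (diag u0)).
  by apply: filterS => u h; apply/setP.
apply: (@near_forall _ u0) => c.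
have [c12|c21] := boolP (c.1 < c.2)%N; last first.
  by apply: (@nearW _ (nbhs u0)) => u; rewrite !inE (negPf c21).
have [cD|cnD] := boolP (c \in crossings (diag u0)).
  have [_ D0 p01 _ _] := crossing_spec g0 (unit_sph _) cD.
  have par01 a : \forall u \near u0, 0 < par u c a < 1.
    have /andP[p0 p1] := p01 a; have cp := @cvg_strand_par c a D0.
    apply: filterS2 (cvgr_lt _ cp _ p1) (cvgr_gt _ cp _ p0) => u h1 h2.
    by rewrite h1 h2.
  have D1 : \forall u \near u0, det u c != 0.
    by exact: (cvgr_neq0 _ (@cvg_det c) D0).
  apply: filterS3 D1 (par01 true) (par01 false) => u h1 h2 h3.
  by apply: (mem_crossings (unit_sph _) c12 h1); case.
have [c_next|c_far] := eqVneq (c.2 : nat) c.1.+1.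
  apply: filterS (near_generic g0) => u g.
  apply: contraFF (erefl false) => /=; rewrite inE c12 /=.
  move=> /asboolP[[s t] [/= hs ht]].
  by move/(consecutive_no_double_point g (unit_sph _) c_next hs ht).
pose f (q : (R * R) * (curve * (R * R))) :=
  proj (sph q.2.2) (edge_point q.2.1 c.1 q.1.1 - edge_point q.2.1 c.2 q.1.2).
have cf q : coord_cvg q f.
  have [c1 c2 c3] := cvg_factors q.
  apply: coord_cvg_proj; first exact: coord_cvg_sphere_point.
  by apply: coord_cvgB; apply: coord_cvg_edge_point => //;
     [exact: cvg_comp c3 cvg_fst|exact: cvg_comp c3 cvg_snd].
have K2 : compact (@unit_itv R `*` @unit_itv R).
  by apply: compact_setX; exact: compact_unit_itv.
have : \forall u \near u0, forall t, (@unit_itv R `*` @unit_itv R) t ->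
    f (t, u) != 0.
  apply: (near_compact_neq0 K2 (fun t _ => cf (t, u0))) => -[s t] [/= hs ht].
  apply/eqP => /proj_eq e.
  have c12R : c.1%:R + 2 <= c.2%:R :> R.
    by rewrite -natrD ler_nat addn2 ltn_neqAle eq_sym c_far.
  move: (hs) (ht); rewrite /unit_itv /= => hs' ht'.
  have [ins|ends] := itv01_cases hs; last first.
    by have := generic_end g0 ht ends e; lra.
  have [int|endt] := itv01_cases ht; last first.
    by have := generic_end g0 hs endt (esym e); lra.
  move/negP: cnD; apply; rewrite inE c12 /=; apply/asboolP.
  by exists (s, t).
apply: filterS => u h; apply: contraFF (erefl false) => /=; rewrite inE c12 /=.
move=> /asboolP[[s t] [/= /andP[/ltW s0 /ltW s1] /andP[/ltW t0 /ltW t1]]].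
move=> /proj_eq e; have : (@unit_itv R `*` @unit_itv R) (s, t).
  by split; rewrite /unit_itv /= ?s0 ?t0.
by move/h; rewrite /f /= e eqxx.
Qed.

Lemma near_same_data : \forall u \near u0, same_data (diag u0) (diag u).
Proof.
have near_signs c : c \in crossings (diag u0) ->
    \forall u \near u0, (0 < gap u c) = (0 < gap u0 c) /\
      (0 < det u c) = (0 < det u0 c).
  move=> cD; have [_ D0 _ _ _] := crossing_spec g0 (unit_sph _) cD.
  apply: filterI.
    apply: (@near_sign _ _ u0 (fun u => gap u c)); first exact: cvg_height_gap.
    exact: height_gap_neq0.
  by apply: (@near_sign _ _ u0 (fun u => det u c)); [exact: cvg_det|].
have near_order c d a b :
    c \in crossings (diag u0) -> d \in crossings (diag u0) ->
    \forall u \near u0,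
      (time u c a < time u d b) = (time u0 c a < time u0 d b).
  move=> cD dD.
  have [_ C0 _ _ _] := crossing_spec g0 (unit_sph _) cD.
  have [_ D0 _ _ _] := crossing_spec g0 (unit_sph _) dD.
  have [[<- <-]|ne] := eqVneq (c, a) (d, b).
    by apply: (@nearW _ (nbhs u0)) => u; rewrite !ltxx.
  have : \forall u \near u0, (0 < time u d b - time u c a) =
      (0 < time u0 d b - time u0 c a).
    apply: (@near_sign _ _ u0 (fun u => time u d b - time u c a)).
      by apply: cvgB; exact: cvg_strand_time.
    rewrite subr_eq0; apply: contra ne => /eqP/esym e; apply/eqP.
    exact: strand_time_inj e.
  by apply: filterS => u; rewrite !subr_gt0.
have signs : \forall u \near u0, forall c, c \in crossings (diag u0) ->
    (0 < gap u c) = (0 < gap u0 c) /\ (0 < det u c) = (0 < det u0 c).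
  by apply: (@near_forall_in _ u0) => c; exact: near_signs.
have orders : \forall u \near u0, forall c, c \in crossings (diag u0) ->
    forall d, d \in crossings (diag u0) -> forall a b,
    (time u c a < time u d b) = (time u0 c a < time u0 d b).
  apply: (@near_forall_in _ u0) => c cD; apply: (@near_forall_in _ u0) => d dD.
  apply: (@near_forall _ u0) => a; apply: (@near_forall _ u0) => b.
  exact: near_order.
near=> u.
have g : generic u.1 (sph u.2) by near: u; exact: near_generic.
have C : crossings (diag u) = crossings (diag u0).
  by near: u; exact: near_crossings.
have Su : forall c, c \in crossings (diag u0) ->
    (0 < gap u c) = (0 < gap u0 c) /\ (0 < det u c) = (0 < det u0 c).
  by near: u; exact: signs.
have Ou : forall c, c \in crossings (diag u0) ->
    forall d, d \in crossings (diag u0) -> forall a b,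
    (time u c a < time u d b) = (time u0 c a < time u0 d b).
  by near: u; exact: orders.
split; first exact: esym C.
split=> [c cD|c d cD dD].
  rewrite (positiveE g0 (unit_sph _) cD) (positiveE g (unit_sph _)) ?C //.
  by have [-> ->] := Su c cD.
have [Sc _] := Su c cD; have [Sd _] := Su d dD.
have cE : c \in crossings (diag u) by rewrite C.
have dE : d \in crossings (diag u) by rewrite C.
have os := unit_sph u0.2; have us := unit_sph u.2.
rewrite (over_timeE g0 os cD) (over_timeE g0 os dD).
rewrite (under_timeE g0 os cD) (under_timeE g0 os dD).
rewrite (over_timeE g us cE) (over_timeE g us dE).
rewrite (under_timeE g us cE) (under_timeE g us dE) Sc Sd.
by split; apply/esym; exact: Ou.
Unshelve. all: by end_near. Qed.

End LocallyConstant.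

(** * Null sets of the plane *)

Section PlaneMeasure.
Variable R : realType.
Implicit Types (z : R * R) (a b c t : R).

Local Notation leb := (@lebesgue_measure R).
Local Notation leb2 := (@lebesgue_measure R \x @lebesgue_measure R)%E.

(** An open set is the union of the boxes with rational data that it
    contains. *)
Lemma open_measurable_plane (A : set (R * R)) : open A ->
  measurable (A : set (measurableTypeR R * measurableTypeR R)).
Proof.
move=> oA; pose box (r : rat * rat * (rat * rat)) : set (R * R) :=
  ball (ratr r.1.1 : R) (ratr r.1.2) `*` ball (ratr r.2.1 : R) (ratr r.2.2).
have -> : A = \bigcup_(r in [set r | box r `<=` A]) box r.
  apply/seteqP; split=> [[x y] Axy|z [r /= rA /rA //]].
  have [e /= e0 eA] := (nbhs_ballP _ _).1 (open_nbhs_nbhs (conj oA Axy)).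
  have [c1 [r1 [xin xsub]]] :=
    open_subball_rat (ball_open x e) (mem_set (ballxx x e0)).
  have [c2 [r2 [yin ysub]]] :=
    open_subball_rat (ball_open y e) (mem_set (ballxx y e0)).
  exists ((c1, r1), (c2, r2)) => /=.
    by move=> [x' y'] [/= /xsub hx /ysub hy]; apply: eA.
  by split=> /=; apply: set_mem.
rewrite bigcup_mkcond; apply: countable_bigcupT_measurable => // r.
case: ifP => _; last exact: measurable0.
by apply: measurableX; exact: measurable_ball.
Qed.

(** An instance of Fubini's theorem: countable sections are null, and so is the
    countable set of exceptional values of the second coordinate. *)
Lemma leb2_ysections0 (A : set (R * R)) (C : set R) :
  measurable (A : set (measurableTypeR R * measurableTypeR R)) -> countable C ->
  (forall y, ~ C y -> countable (ysection A y)) -> leb2 A = 0%E.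
Proof.
move=> mA cC hA.
rewrite (product_measure_unique (m' := (leb \x^ leb)%E)) //; last first.
  by move=> X Y mX mY; exact: product_measure2E.
have mC : measurable (C : set (measurableTypeR R)).
  exact: countable_measurable.
rewrite /product_measure2.
transitivity (\int[leb]_(y in setT) cst 0%E y)%E; last exact: integral0.
apply: ae_eq_integral => //; first by apply: measurable_fun_ysection.
exists C; split => //; first exact: countable_lebesgue_measure0.
move=> y /=; apply: contra_notP => nC _ /=.
by apply: countable_lebesgue_measure0; exact: hA.
Qed.

#[global] Instance leb2_ae_filter : Filter (nbhs (almost_everywhere leb2)).
Proof. exact: ae_filter_ringOfSetsType. Qed.

End PlaneMeasure.

(** * Zeros of binary forms in cosine and sine *)

Section Trigonometry.
Variable R : realType.
Implicit Types (a b c t : R).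

Lemma countableS (T : Type) (A B : set T) :
  A `<=` B -> countable B -> countable A.
Proof. by move=> AB; apply: sub_countable; exact: subset_card_le. Qed.

Lemma countable_setU (T : Type) (A B : set T) :
  countable A -> countable B -> countable (A `|` B).
Proof.
move=> cA cB; rewrite -bigcup2E; apply: bigcup_countable => //.
by move=> [|[|i]] _ //=; exact: countable0.
Qed.

Lemma countable_sin0 t0 : countable [set t | sin (t - t0) = 0 :> R].
Proof.
pose zero (bm : bool * nat) := t0 + (-1) ^+ bm.1 * (pi *+ bm.2) : R.
apply: (@countableS _ _ (range zero)); last first.
  by apply: sub_countable (card_image_le _ _) _; exact: countableP.
have pos s : 0 <= s -> sin s = 0 -> exists m, s = pi *+ m :> R.
  move=> s0 sin0; have pi0 := pi_gt0 R; set m := Num.truncn (s / pi); exists m.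
  have /andP[m1 m2] : m%:R <= s / pi < m.+1%:R.
    by apply: Num.Theory.truncn_itv; rewrite divr_ge0 // ltW.
  rewrite ler_pdivlMr // in m1; rewrite ltr_pdivrMr // in m2.
  have := alternatingn (@sinDpi R) m (s - pi *+ m).
  rewrite subrK sin0 => /esym/eqP; rewrite mulf_eq0 signr_eq0 /= => /eqP sr0.
  apply/eqP; rewrite -subr_eq0 eq_le; apply/andP; split; last first.
    by rewrite subr_ge0 -mulr_natl.
  rewrite leNgt; apply/negP => r0.
  have : 0 < s - pi *+ m < pi.
    by rewrite r0 /= ltrBlDr -mulrS -mulr_natl.
  by move=> /sin_gt0_pi; rewrite sr0 ltxx.
move=> t /= sin0; have [h|h] := leP 0 (t - t0).
  have [m tm] := pos _ h sin0; exists (false, m) => //.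
  by rewrite /zero /= expr0 mul1r -tm addrC subrK.
have [||m tm] := pos (- (t - t0)); first by rewrite oppr_ge0 ltW.
  by rewrite sinN sin0 oppr0.
exists (true, m) => //.
by rewrite /zero /= expr1 mulN1r -tm opprK addrC subrK.
Qed.

Lemma rotation t t0 :
  cos t = cos t0 * cos (t - t0) - sin t0 * sin (t - t0) /\
  sin t = sin t0 * cos (t - t0) + cos t0 * sin (t - t0).
Proof.
split; first by rewrite -cosD addrC subrK.
by rewrite -sinD addrC subrK.
Qed.

(** A linear form that vanishes at [t0] is a multiple of [sin (t - t0)]. *)
Lemma countable_linear_trig a b : (a != 0) || (b != 0) ->
  countable [set t | a * cos t + b * sin t = 0].
Proof.
move=> ab0.
have [[t0 e0]|none] := pselect (exists t, a * cos t + b * sin t = 0);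
  last first.
  apply: (@countableS _ _ set0); last exact: countable0.
  by move=> t ht; apply: none; exists t.
apply: (countableS _ (countable_sin0 t0)) => t /=.
have [-> ->] := rotation t t0.
set u := cos (t - t0); set v := sin (t - t0) => h.
have {}h : (b * cos t0 - a * sin t0) * v = 0.
  transitivity (a * (cos t0 * u - sin t0 * v) + b * (sin t0 * u + cos t0 * v) -
    (a * cos t0 + b * sin t0) * u); first by ring.
  by rewrite h e0 mul0r subr0.
move/eqP: h; rewrite mulf_eq0 => /orP[/eqP h|/eqP //].
have cs := cos2Dsin2 t0; exfalso; move: ab0.
have -> : a = 0.
  transitivity (a * (cos t0 ^+ 2 + sin t0 ^+ 2)); first by rewrite cs mulr1.
  transitivity ((a * cos t0 + b * sin t0) * cos t0 -
    (b * cos t0 - a * sin t0) * sin t0); first by ring.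
  by rewrite h e0 !mul0r subr0.
have -> : b = 0.
  transitivity (b * (cos t0 ^+ 2 + sin t0 ^+ 2)); first by rewrite cs mulr1.
  transitivity ((a * cos t0 + b * sin t0) * sin t0 +
    (b * cos t0 - a * sin t0) * cos t0); first by ring.
  by rewrite h e0 !mul0r addr0.
by rewrite eqxx.
Qed.

(** A quadratic form in [(cos t, sin t)] that vanishes at [t0] is the product of
    [sin (t - t0)] and of a linear form, which is nonzero if the quadratic form
    is. *)
Lemma countable_quadratic_trig a b c : [|| a != 0, b != 0 | c != 0] ->
  countable [set t | a * cos t ^+ 2 + b * (cos t * sin t) + c * sin t ^+ 2 = 0].
Proof.
move=> abc; have [[t0 e0]|none] := pselect (exists t,
    a * cos t ^+ 2 + b * (cos t * sin t) + c * sin t ^+ 2 = 0); last first.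
  apply: (@countableS _ _ set0); last exact: countable0.
  by move=> t ht; apply: none; exists t.
set C := cos t0 in e0; set S := sin t0 in e0.
have cs : C ^+ 2 + S ^+ 2 = 1 by exact: cos2Dsin2.
pose p := 2 * (c - a) * (S * C) + b * (C ^+ 2 - S ^+ 2).
pose q := a * S ^+ 2 - b * (S * C) + c * C ^+ 2.
(* In the frame rotated by [t0], the coefficient of [u ^+ 2] is the value of
   the form at [t0]. *)
have factor u v : a * (C * u - S * v) ^+ 2 +
    b * ((C * u - S * v) * (S * u + C * v)) + c * (S * u + C * v) ^+ 2 =
    v * (p * u + q * v).
  transitivity ((a * C ^+ 2 + b * (C * S) + c * S ^+ 2) * u ^+ 2 +
    v * (p * u + q * v)).
    by rewrite /p /q; ring.
  by rewrite e0 mul0r add0r.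
have pq : (p != 0) || (q != 0).
  apply/negP => /negP; rewrite negb_or !negbK => /andP[/eqP p0 /eqP q0].
  have Z x y : a * x ^+ 2 + b * (x * y) + c * y ^+ 2 = 0.
    have := factor (C * x + S * y) (C * y - S * x).
    have -> : C * (C * x + S * y) - S * (C * y - S * x) =
        (C ^+ 2 + S ^+ 2) * x by ring.
    have -> : S * (C * x + S * y) + C * (C * y - S * x) =
        (C ^+ 2 + S ^+ 2) * y by ring.
    by rewrite cs !mul1r p0 q0 !mul0r addr0 mulr0.
  have a0 : a = 0.
    by have := Z 1 0; rewrite expr1n expr0n /= !mulr0 mulr1 !addr0.
  have c0 : c = 0.
    by have := Z 0 1; rewrite expr1n expr0n /= mul0r !mulr0 mulr1 !add0r.
  have b0 : b = 0 by have := Z 1 1; rewrite a0 c0 !mul0r !mulr1 add0r addr0.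
  by move: abc; rewrite a0 b0 c0 eqxx.
have c1 : countable [set t | sin (t - t0) = 0] by exact: countable_sin0.
have c2 : countable
    [set t | (p * C - q * S) * cos t + (p * S + q * C) * sin t = 0].
  apply: countable_linear_trig; apply/negP => /negP.
  rewrite negb_or !negbK => /andP[/eqP h1 /eqP h2]; move: pq.
  have -> : p = 0.
    transitivity (p * (C ^+ 2 + S ^+ 2)); first by rewrite cs mulr1.
    transitivity ((p * C - q * S) * C + (p * S + q * C) * S); first by ring.
    by rewrite h1 h2 !mul0r addr0.
  have -> : q = 0.
    transitivity (q * (C ^+ 2 + S ^+ 2)); first by rewrite cs mulr1.
    transitivity ((p * S + q * C) * C - (p * C - q * S) * S); first by ring.
    by rewrite h1 h2 !mul0r subr0.
  by rewrite eqxx.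
apply: countableS (countable_setU c1 c2) => t /=.
have [ct st] := rotation t t0; rewrite ct st -/C -/S.
set u := cos (t - t0); set v := sin (t - t0).
rewrite factor => /eqP; rewrite mulf_eq0 => /orP[/eqP|/eqP h]; [by left|right].
transitivity ((C ^+ 2 + S ^+ 2) * (p * u + q * v)); first by ring.
by rewrite h mulr0.
Qed.

End Trigonometry.

(** * Almost all directions are generic *)

Section NullCones.
Variable R : realType.
Implicit Types (u v w x : 'rV[R]_3) (f g : 'rV[R]_3 -> R).

Local Notation leb2 := (@lebesgue_measure R \x @lebesgue_measure R)%E.
Local Notation sph z := (sphere_point z.1 z.2).

Definition linear_form f := exists a b c, forall x,
  f x = a * x 0 0 + b * x 0 1 + c * x 0 2%:R.

Definition quadratic_form f := exists a b c d e h, forall x,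
  f x = a * x 0 0 ^+ 2 + b * (x 0 0 * x 0 1) + c * x 0 1 ^+ 2 +
    (d * x 0 0 + e * x 0 1) * x 0 2%:R + h * x 0 2%:R ^+ 2.

Lemma quadratic_formM f g : linear_form f -> linear_form g ->
  quadratic_form (fun x => f x * g x).
Proof.
move=> [a [b [c hf]]] [a' [b' [c' hg]]].
exists (a * a'), (a * b' + b * a'), (b * b'), (a * c' + c * a').
exists (b * c' + c * b'), (c * c') => x.
by rewrite hf hg; ring.
Qed.

Lemma quadratic_formD f g : quadratic_form f -> quadratic_form g ->
  quadratic_form (fun x => f x + g x).
Proof.
move=> [a [b [c [d [e [h hf]]]]]] [a' [b' [c' [d' [e' [h' hg]]]]]].
exists (a + a'), (b + b'), (c + c'), (d + d'), (e + e'), (h + h') => x.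
by rewrite hf hg; ring.
Qed.

Lemma linear_form_dot u : linear_form (dot u).
Proof. by exists (u 0 0), (u 0 1), (u 0 2%:R) => x; rewrite dotE. Qed.

Lemma linear_form_triple u v : linear_form (triple u v).
Proof.
exists (u 0 1 * v 0 2%:R - u 0 2%:R * v 0 1).
exists (u 0 2%:R * v 0 0 - u 0 0 * v 0 2%:R).
exists (u 0 0 * v 0 1 - u 0 1 * v 0 0) => x.
by rewrite tripleE; ring.
Qed.

Lemma quadratic_form_concurrency u v w x y :
  quadratic_form (concurrency u v w x y).
Proof.
have mid a b : linear_form (fun z => triple a z b).
  have [p [q [r h]]] := linear_form_triple b a.
  by exists p, q, r => z; rewrite -h !tripleE; ring.
apply: quadratic_formD; apply: quadratic_formM; try exact: mid;
exact: linear_form_triple.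
Qed.

Lemma sph_coord (z : R * R) :
  [/\ sph z 0 0 = sin z.1 * cos z.2, sph z 0 1 = sin z.1 * sin z.2 &
      sph z 0 2%:R = cos z.1].
Proof. by rewrite !mxE. Qed.

(** At a fixed second angle [t], [f] is the binary form with coefficients [h],
    [q t] and [p t] in the first angle. If [f] is not zero and all of them
    vanish at some [t], then these [t] are the zeros of a nonzero form in
    [(cos t, sin t)], or among them. *)
Lemma null_cone f : quadratic_form f -> (exists x, f x != 0) ->
  {ae leb2, forall z, f (sph z) != 0}.
Proof.
move=> [a [b [c [d [e [h fE]]]]]] [x fx0].
pose A := [set z : R * R | f (sph z) = 0].
have oA : open (~` A).
  rewrite openE => z /= /eqP Az; have cz k : sph q 0 k @[q --> z] --> sph z 0 k.
    by apply: (@coord_cvg_sphere_point _ _ z id); exact: cvg_id.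
  have cf : f (sph q) @[q --> z] --> f (sph z).
    rewrite fE; under eq_fun do rewrite fE.
    have sq k l : sph q 0 k * sph q 0 l @[q --> z] --> sph z 0 k * sph z 0 l.
      by apply: cvgM.
    apply: cvgD; [apply: cvgD; [apply: cvgD; [apply: cvgD|]|]|].
    - by apply: cvgM; [exact: cvg_cst|exact: sq].
    - by apply: cvgM; [exact: cvg_cst|exact: sq].
    - by apply: cvgM; [exact: cvg_cst|exact: sq].
    - apply: cvgM; last exact: cz.
      by apply: cvgD; apply: cvgM; (exact: cvg_cst || exact: cz).
    - by apply: cvgM; [exact: cvg_cst|exact: sq].
  have : \forall q \near z, f (sph q) != 0 by exact: (cvgr_neq0 _ cf Az).
  by apply: filterS => q /eqP.
have mA : measurable (A : set (measurableTypeR R * measurableTypeR R)).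
  by rewrite -[A]setCK; apply: measurableC; exact: open_measurable_plane.
pose p t := a * cos t ^+ 2 + b * (cos t * sin t) + c * sin t ^+ 2.
pose q t := d * cos t + e * sin t.
have fsph s t : f (sph (s, t)) =
    h * cos s ^+ 2 + q t * (cos s * sin s) + p t * sin s ^+ 2.
  by rewrite fE; have [-> -> ->] := sph_coord (s, t); rewrite /p /q /=; ring.
pose C := [set t | [/\ p t = 0, q t = 0 & h = 0]].
have cC : countable C.
  have [h0|h0] := eqVneq h 0; last first.
    apply: (@countableS _ _ set0); last exact: countable0.
    by move=> t [_ _ /eqP]; rewrite (negPf h0).
  have [de|] := boolP ((d != 0) || (e != 0)).
    by apply: countableS (countable_linear_trig de) => t [].
  rewrite negb_or !negbK => /andP[/eqP d0 /eqP e0].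
  have abc : [|| a != 0, b != 0 | c != 0].
    apply: contraNT fx0; rewrite !negb_or !negbK.
    move=> /and3P[/eqP a0 /eqP b0 /eqP c0].
    by rewrite fE a0 b0 c0 d0 e0 h0; apply/eqP; ring.
  by apply: countableS (countable_quadratic_trig abc) => t [].
have A0 : leb2 A = 0%E.
  apply: (leb2_ysections0 mA cC) => t nC.
  have hqp : [|| h != 0, q t != 0 | p t != 0].
    apply/negP => /negP; rewrite !negb_or !negbK.
    move=> /and3P[/eqP h0 /eqP q0 /eqP p0].
    exact: nC.
  apply: countableS (countable_quadratic_trig hqp) => s.
  by rewrite /ysection /= inE /A /= fsph.
by exists A; split => // z /= /negP; rewrite negbK => /eqP.
Qed.

End NullCones.

Section GenericDirections.
Variables (R : realType) (n : nat) (l : 'M[R]_(n.+2, 3)).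
Hypothesis simple_l : simple_open l.
Implicit Types (i j k : 'I_n.+1) (s t : R) (xi : 'rV[R]_3).

Local Notation leb2 := (@lebesgue_measure R \x @lebesgue_measure R)%E.
Local Notation sph z := (sphere_point z.1 z.2).
Local Notation ep := (edge_point l).
Local Notation ev := (edge_vector l).
Local Notation start i := (vertex l (widen_ord (leqnSn n.+1) i)).

Lemma vertex_on_curve (v : 'I_n.+2) : exists j s,
  [/\ 0 <= s <= 1, ep j s = vertex l v & j%:R + s = v%:R].
Proof.
have [j ->|->] := unliftP ord0 v.
  exists j, 1; split; first by rewrite ler01 lexx.
    exact: edge_point1.
  by rewrite lift0 natr1.
exists ord0, 0; split; first by rewrite lexx ler01.
  by rewrite edge_point0; congr vertex; apply: val_inj.
by rewrite /= addr0.
Qed.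

Lemma simple_edge i : ev i != 0.
Proof.
apply/eqP => h; have : i%:R + 0 = i%:R + 1 :> R.
  by apply: simple_l; rewrite ?lexx ?ler01 // /edge_point h !scaler0.
by lra.
Qed.

(** A vector of a plane through the origin that does not contain [xi] is
    determined by its projection along [xi]. *)
Lemma proj_eq0_transverse xi x y t (w : 'rV[R]_3) :
  dot w x = 0 -> dot w y = 0 -> dot w xi != 0 ->
  proj xi (x + t *: y) = 0 -> x + t *: y = 0.
Proof.
move=> nx ny nxi /proj_eq0; set c := dot _ xi => h.
have : dot w (x + t *: y) = 0.
  transitivity (dot w x + t * dot w y); first by rewrite !dotE !mxE; ring.
  by rewrite nx ny mulr0 addr0.
rewrite h; have -> : dot w (c *: xi) = c * dot w xi.
  by rewrite !dotE !mxE; ring.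
by move/eqP; rewrite mulf_eq0 (negPf nxi) orbF => /eqP ->; rewrite scale0r.
Qed.

(** The first hypothesis gives a plane containing the edge [i] and the vertex
    [v] and not parallel to [xi]; the two others keep [xi] out of the planes and
    cones that are proper. For two edges with parallel directions, the plane
    through one of them and the start of the other contains both. *)
Lemma regular_generic xi : dot xi xi = 1 ->
  (forall i (v : 'I_n.+2), exists w, [/\ dot w (start i - vertex l v) = 0,
     dot w (ev i) = 0 & dot w xi != 0]) ->
  (forall i j, (exists x, triple (ev i) (ev j) x != 0) ->
     triple (ev i) (ev j) xi != 0) ->
  (forall i j k,
     let F := concurrency (ev i) (ev j) (ev k)
       (start j - start i) (start k - start i) in
     (exists x, F x != 0) -> F xi != 0) ->
  generic l xi.
Proof.
move=> xi1 planes transverse cones; split=> [i t v t01 /proj_eq e|].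
  have [w [n1 n2 n3]] := planes i v.
  have [j [s [s01 js <-]]] := vertex_on_curve v.
  apply: simple_l => //; rewrite js; apply/eqP; rewrite -subr_eq0; apply/eqP.
  by move: e; rewrite /edge_point addrAC => /(proj_eq0_transverse n1 n2 n3).
have far i j s t : i != j -> 0 < s < 1 -> 0 < t < 1 -> ep i s - ep j t != 0.
  move=> ij hs ht; rewrite subr_eq0; apply: contra ij => /eqP e.
  have [ws wt] : 0 <= s <= 1 /\ 0 <= t <= 1 by split; lra.
  by have /add_nat_inj[//|//|/val_inj -> _] := simple_l ws wt e.
have cross i j s t : i != j -> 0 < s < 1 -> 0 < t < 1 ->
    proj xi (ep i s) = proj xi (ep j t) -> triple (ev i) (ev j) xi != 0.
  move=> ij hs ht /proj_eq e; apply: transverse.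
  have [//|none] := pselect (exists x, triple (ev i) (ev j) x != 0); exfalso.
  have [x|a ha] := triple0_parallel (simple_edge i) (v := ev j).
    by apply/eqP/negPn/negP => h; apply: none; exists x.
  have [w [n1 n2 n3]] := planes i (widen_ord (leqnSn n.+1) j).
  have /eqP[] := far i j s t ij hs ht; move: e.
  have -> : ep i s - ep j t = (start i - start j) + (s - t * a) *: ev i.
    by rewrite /edge_point ha scalerA scalerBl opprD addrACA.
  exact: (proj_eq0_transverse n1 n2 n3).
move=> i1 i2 i3 t1 t2 t3; rewrite /= !inE negb_or andbT.
move=> /andP[/andP[n12 n13] n23].
move=> h1 h2 h3 [e12 e23]; have e13 := etrans e12 e23.
have c12 := cross _ _ _ _ n12 h1 h2 e12.
have c31 : triple (ev i3) (ev i1) xi != 0.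
  by apply: cross (esym e13); rewrite // eq_sym.
have along i j s t : proj xi (ep i s) = proj xi (ep j t) ->
    exists a, ep i s - ep j t = a *: xi.
  by move/proj_eq/proj_eq0 => h; exists (dot (ep i s - ep j t) xi).
have [a ha] := along _ _ _ _ (esym e12).
have [b hb] := along _ _ _ _ (esym e13).
(* [(b - a) xi] joins the second point to the third one. *)
have ab : b - a != 0.
  apply/eqP => ab0; have n32 : i3 != i2 by rewrite eq_sym.
  have /eqP[] := far _ _ _ _ n32 h3 h2.
  transitivity ((ep i3 t3 - ep i1 t1) - (ep i2 t2 - ep i1 t1)).
    by rewrite opprB addrA subrK.
  by rewrite ha hb -scalerBl ab0 scale0r.
have shape k s c : ep k s - ep i1 t1 = c *: xi ->
    start k - start i1 = c *: xi + t1 *: ev i1 - s *: ev k.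
  by move=> <-; rewrite /edge_point opprD addrA subrK addrAC addrK.
have := cones i1 i2 i3; rewrite /= (shape _ _ _ ha) (shape _ _ _ hb).
rewrite concurrency_zero eqxx => contra; suff : false by [].
by apply: contra; exists (xi + ev i1); rewrite concurrency_nonzero !mulf_neq0.
Qed.

Lemma generic_ae : {ae leb2, forall z, generic l (sph z)}.
Proof.
have cone f : quadratic_form f ->
    {ae leb2, forall z, (exists x, f x != 0) -> f (sph z) != 0}.
  move=> qf; have [ex|nex] := pselect (exists x, f x != 0).
    by apply: filterS (null_cone qf ex) => z.
  exact: aeW.
have plane i (v : 'I_n.+2) : {ae leb2, forall z, exists w,
    [/\ dot w (start i - vertex l v) = 0, dot w (ev i) = 0 &
        dot w (sph z) != 0]}.
  have [w w0 [n1 n2]] := exists_normal (start i - vertex l v) (ev i).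
  have q : quadratic_form (fun x => dot w x * dot w x).
    by apply: quadratic_formM; exact: linear_form_dot.
  have ex : exists x, dot w x * dot w x != 0.
    by exists w; rewrite mulf_neq0 // gt_eqF // dot_gt0.
  apply: filterS (null_cone q ex) => z; rewrite mulf_eq0 orbb => h.
  by exists w.
have P1 : {ae leb2, forall z, forall i (v : 'I_n.+2), exists w,
    [/\ dot w (start i - vertex l v) = 0, dot w (ev i) = 0 &
        dot w (sph z) != 0]}.
  by apply: filter_forall => i; apply: filter_forall => v; exact: plane.
have P2 : {ae leb2, forall z, forall i j,
     (exists x, triple (ev i) (ev j) x != 0) ->
     triple (ev i) (ev j) (sph z) != 0}.
  apply: filter_forall => i; apply: filter_forall => j.
  have q : quadratic_form
      (fun x => triple (ev i) (ev j) x * triple (ev i) (ev j) x).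
    by apply: quadratic_formM; exact: linear_form_triple.
  apply: filterS (cone _ q) => z h [x hx].
  by have := h (ex_intro _ x (mulf_neq0 hx hx)); rewrite mulf_eq0 orbb.
have P3 : {ae leb2, forall z, forall i j k,
     let F := concurrency (ev i) (ev j) (ev k)
       (start j - start i) (start k - start i) in
     (exists x, F x != 0) -> F (sph z) != 0}.
  apply: filter_forall => i; apply: filter_forall => j.
  apply: filter_forall => k.
  exact/cone/quadratic_form_concurrency.
apply: filterS3 P1 P2 P3 => z; apply: regular_generic.
exact: dot_sphere_point.
Qed.

End GenericDirections.

(** * Convergence of the integrals *)

Section Measure.
Variables (R : realType) (n k : nat).
Local Notation curve := 'M[R]_(n.+2, 3).
Implicit Types (l : curve) (z : R * R).

Local Notation leb2 := (@lebesgue_measure R \x @lebesgue_measure R)%E.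
Local Notation plane := (measurableTypeR R * measurableTypeR R)%type.
Local Notation sph z := (sphere_point z.1 z.2).

Definition polygon_state_sum l z : R :=
  (state_sum (projection_diagram l (sph z)) k)%:~R.

Definition generic_set l : set (R * R) := [set z | generic l (sph z)].

Definition angle_box : set (R * R) := `[0, pi] `*` `[0, 2 * pi].

(** Extended by zero outside of the generic directions, so that the domain of
    integration is [angle_box] for all curves. *)
Definition integrand l : plane -> \bar R :=
  (fun z => (polygon_state_sum l z * sin z.1)%:E) \_ (generic_set l).

Lemma near_polygon_state_sum l0 z0 : simple_open l0 -> generic l0 (sph z0) ->
  \forall u \near (l0, z0), generic u.1 (sph u.2) /\
     polygon_state_sum u.1 u.2 = polygon_state_sum l0 z0.
Proof.
move=> s0 g0; apply: filterI; first exact: (@near_generic _ _ (l0, z0)).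
have := @near_same_data _ _ (l0, z0) s0 g0.
by apply: filterS => u /state_sum_same_data e; rewrite /polygon_state_sum -e.
Qed.

Lemma near_fixed_curve l z (P : curve * (R * R) -> Prop) :
  (\forall u \near (l, z), P u) -> \forall z' \near z, P (l, z').
Proof.
have h : (l, z') @[z' --> z] --> (l, z).
  exact: (@cvg_pair _ _ _ (nbhs z) (nbhs l) (nbhs z) _ _ _ (fun=> l) id
    (cvg_cst l) (@cvg_id _ (nbhs z))).
exact: h.
Qed.

Lemma measurable_generic_set l : simple_open l ->
  measurable (generic_set l : set plane).
Proof.
move=> sl; apply: open_measurable_plane; rewrite openE => z gz.
apply: filterS (near_fixed_curve (near_polygon_state_sum sl gz)) => z' [].
by [].
Qed.

Lemma measurable_angle_box : measurable (angle_box : set plane).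
Proof. by apply: measurableX; exact: measurable_itv. Qed.

(** On generic directions the state sum is locally constant, so the preimages of
    all sets under it are open. *)
Lemma measurable_integrand l : simple_open l ->
  measurable_fun (angle_box : set plane) (integrand l).
Proof.
move=> sl; have mG := measurable_generic_set sl.
apply/(measurable_restrict _ mG measurable_angle_box).
apply: (measurable_funS mG); first exact: subIsetr.
apply/measurable_EFinP; apply: measurable_funM.
  move=> _ Y mY; apply: open_measurable_plane; rewrite openE => z [gz Yz].
  have := near_fixed_curve (near_polygon_state_sum sl gz).
  apply: filterS => z' [gz' e].
  split; first exact: gz'.
  by rewrite /preimage /= e; exact: Yz.
apply: measurable_funS (measurableT) _ _ => //.
apply: (measurableT_comp _ measurable_fst).
by apply: continuous_measurable_fun; exact: continuous_sin.
Qed.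

Lemma integrand_bounded : exists M : R, 0 <= M /\
  forall l z, (`|integrand l z| <= M%:E)%E.
Proof.
have [M hM] := state_sum_bounded R ('I_n.+1 * 'I_n.+1)%type k.
have M0 : 0 <= M.
  by rewrite (le_trans _ (hM (projection_diagram (0 : curve) 0))).
exists M; split=> // l z; rewrite /integrand /patch; case: ifP => _; last first.
  by rewrite abse0 lee_fin.
rewrite abse_EFin lee_fin normrM -[M]mulr1.
by apply: ler_pM => //; [exact: hM|exact: sin_max].
Qed.

Lemma integrable_angle_box (M : R) : 0 <= M ->
  leb2.-integrable (angle_box : set plane) (cst M%:E).
Proof.
move=> M0; apply/integrableP; split; first exact: measurable_cst.
under eq_integral do rewrite /= ger0_norm //.
rewrite integral_cst; last exact: measurable_angle_box.
have fin a b : (@lebesgue_measure R `[a, b] \is a fin_num)%E.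
  by rewrite lebesgue_measure_itv; case: ifP.
rewrite [X in (_ * X < _)%E](_ : _ = (@lebesgue_measure R `[0%R, pi] *
    @lebesgue_measure R `[0%R, (2 * pi)%R])%E).
  by rewrite ltey_eq !fin_numM.
by apply: product_measure1E; exact: measurable_itv.
Qed.

Lemma vassiliev_measureE l : vassiliev_measure l k =
  (-1) ^+ k / (4 * pi * 2 ^+ k * k`!%:R) *
  fine (\int[leb2]_(z in (angle_box : set plane)) integrand l z)%E.
Proof.
rewrite /vassiliev_measure /sphere_integral /Rintegral; congr (_ * fine _).
rewrite /integrand -integral_mkcondr; congr (integral _ _ _).
apply/seteqP; split=> z /= [].
  by move=> h1 h2 h3; split=> //; split; rewrite /= in_itv.
by rewrite /angle_box /= !in_itv /= => -[h1 h2] h3.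
Qed.

Lemma vassiliev_measure_cvg (u : curve^nat) l : simple_open l ->
  (forall m, simple_open (u m)) -> u @ \oo --> l ->
  vassiliev_measure (u m) k @[m --> \oo] --> vassiliev_measure l k.
Proof.
move=> sl su ul; have [M [M0 hM]] := integrand_bounded.
have ae_cvg : {ae leb2, forall z, angle_box z ->
    integrand (u m) z @[m --> \oo] --> integrand l z}.
  apply: filterS (generic_ae sl) => z gz _; apply: cvg_near_cst.
  have uz : (u m, z) @[m --> \oo] --> (l, z).
    exact: (@cvg_pair _ _ _ \oo (nbhs l) (nbhs z) _ _ _ u (fun=> z)
      ul (cvg_cst z)).
  have near_m : \forall m \near \oo, generic (u m) (sph z) /\
      polygon_state_sum (u m) z = polygon_state_sum l z.
    exact: uz (near_polygon_state_sum sl gz).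
  apply: filterS near_m => m [gm em]; rewrite /integrand /patch.
  have -> : z \in generic_set (u m).
    exact: (@mem_set _ (generic_set (u m)) z gm).
  have -> : z \in generic_set l.
    exact: (@mem_set _ (generic_set l) z gz).
  by rewrite em.
have ae_bound : {ae leb2, forall z, forall m, angle_box z ->
    (`|integrand (u m) z| <= cst M%:E z)%E}.
  by apply: aeW => z m _; exact: hM.
have [il _ conv] := dominated_convergence measurable_angle_box
  (fun m => measurable_integrand (su m)) (measurable_integrand sl) ae_cvg
  (integrable_angle_box M0) ae_bound.
rewrite vassiliev_measureE; under eq_fun do rewrite vassiliev_measureE.
apply: cvgMl_tmp; apply: fine_cvg; rewrite fineK; first exact: conv.
exact: (integrable_fin_num measurable_angle_box il).
Qed.

End Measure.

Theorem proposition3p4 (R : realType) (n k : nat) :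
  {within [set l : 'M[R]_(n.+2, 3) | simple_open l],
    continuous (fun l : 'M[R]_(n.+2, 3) => vassiliev_measure l k)}.
Proof.
(* The neighbourhoods of a curve have a countable basis of balls, so sequences
   are enough. *)
apply/subspace_continuousP => l sl; apply/cvgrPdist_lt => e e0.
rewrite /within /=; apply: contrapT => none.
pose far m l' := [/\ ball l m.+1%:R^-1 l', simple_open l' &
  ~ (`|vassiliev_measure l k - vassiliev_measure l' k| < e)].
have /choice[u uP] : forall m, exists l', far m l'.
  move=> m; apply: contrapT => no_l'; apply: none.
  apply/nbhs_ballP; exists (m.+1%:R^-1) => /=; first by rewrite invr_gt0.
  by move=> l' bl' sl'; apply: contrapT => far_l'; apply: no_l'; exists l'.
have ul : u @ \oo --> l.
  apply/cvg_ballP => d d0; near=> m.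
  have [+ _ _] := uP m; apply: le_ball; apply: ltW.
  by near: m; exact: (near_infty_natSinv_lt (PosNum d0)).
have su m : simple_open (u m) by have [] := uP m.
have /cvgrPdist_lt/(_ e e0) := @vassiliev_measure_cvg R n k u l sl su ul.
by move=> [N _ /(_ N (leqnn N))] /=; have [_ _] := uP N.
Unshelve. all: by end_near. Qed.
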